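(* Let $f:X\longrightarrow Y$ be a weak S-homotopy equivalence of flows. Then $\mathrm{ho}\mathbb{P}^-f:\mathrm{ho}\mathbb{P}^-X\longrightarrow\mathrm{ho}\mathbb{P}^-Y$ is a homotopy equivalence between cofibrant topological spaces.
   Context: $\mathbf{Top}$ is the category of compactly generated topological spaces (weak Hausdorff $k$-spaces), with the model structure whose weak equivalences are the weak homotopy equivalences and whose fibrations are the Serre fibrations; ''cofibrant topological space'' refers to this model structure. A flow $X$ consists of a compactly generated space $\mathbb{P}X$ (the path space), a discrete space $X^0$ (the set of states), continuous maps $s,t:\mathbb{P}X\to X^0$, and a continuous associative map $*:\{(x,y)\in\mathbb{P}X\times\mathbb{P}X;\ t(x)=s(y)\}\to\mathbb{P}X$ with $s(x*y)=s(x)$ and $t(x*y)=t(y)$. A morphism of flows $f:X\to Y$ consists of a set map $f^0:X^0\to Y^0$ and a continuous map $\mathbb{P}f:\mathbb{P}X\to\mathbb{P}Y$ compatible with $s$, $t$ and $*$. The category of flows is $\mathbf{Flow}$. It carries a unique model structure such that: the weak equivalences are the weak S-homotopy equivalences, i.e. the morphisms $f$ with $f^0$ a bijection and $\mathbb{P}f$ a weak homotopy equivalence; the fibrations are the morphisms $f$ with $\mathbb{P}f$ a Serre fibration. (This model structure may be taken as known.) $Q$ denotes its cofibrant replacement functor: $\varnothing\to X$ factors functorially as a cofibration $\varnothing\to Q(X)$ followed by a trivial fibration $Q(X)\to X$. The branching space $\mathbb{P}^-X$ of a flow $X$ is the compactly generated space equipped with a continuous map $h^-:\mathbb{P}X\to\mathbb{P}^-X$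 universal among continuous maps $\phi$ from $\mathbb{P}X$ to compactly generated spaces with $\phi(x)=\phi(x*y)$ whenever $t(x)=s(y)$. The homotopy branching space is $\mathrm{ho}\mathbb{P}^-X:=\mathbb{P}^-Q(X)$, and $\mathrm{ho}\mathbb{P}^-f:=\mathbb{P}^-Q(f)$. *)

(* Defs.v *)
From HB Require Import structures.
From mathcomp Require Import all_boot all_order all_algebra.
From mathcomp Require Import all_classical all_reals topology.

Set Implicit Arguments.
Unset Strict Implicit.
Unset Printing Implicit Defensive.

Import Order.TTheory GRing.Theory Num.Theory numFieldTopology.Exports.

Local Open Scope classical_set_scope.

(** * Categories, lifting properties, model structures *)

Record category := Category {
  obj :> Type;
  hom : obj -> obj -> Type;
  idm : forall A, hom A A;
  compm : forall A B C, hom B C -> hom A B -> hom A C;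
  compm1 : forall A B (f : hom A B), compm f (idm A) = f;
  comp1m : forall A B (f : hom A B), compm (idm B) f = f;
  compmA : forall A B C D (f : hom A B) (g : hom B C) (h : hom C D),
    compm h (compm g f) = compm (compm h g) f
}.

Record functor (C D : category) := Functor {
  fobj :> C -> D;
  fhom : forall A B, hom A B -> hom (fobj A) (fobj B);
  fhom1 : forall A, fhom (idm A) = idm (fobj A);
  fhomM : forall A B E (f : hom A B) (g : hom B E),
    fhom (compm g f) = compm (fhom g) (fhom f)
}.

Record initial_object (C : category) := InitialObject {
  initial :> C;
  from_initial : forall A : C, hom initial A;
  from_initial_uniq : forall (A : C) (f : hom initial A), f = from_initial A
}.

Definition morphism_class (C : category) := forall A B : C, hom A B -> Prop.

Definition has_lifting (C : category) (A B E F : C) (i : hom A B)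
    (p : hom E F) :=
  forall (u : hom A E) (v : hom B F), compm p u = compm v i ->
    exists h : hom B E, compm h i = u /\ compm p h = v.

Definition is_retract (C : category) (A B A' B' : C) (f : hom A B)
    (g : hom A' B') :=
  exists (a : hom A A') (r : hom A' A) (b : hom B B') (s : hom B' B),
    [/\ compm r a = idm A, compm s b = idm B,
        compm g a = compm b f & compm f r = compm s g].

Definition trivial_fibration (C : category) (W F : morphism_class C) :
    morphism_class C :=
  fun A B p => W A B p /\ F A B p.

(** The cofibrations of a model structure with weak equivalences [W] and
    fibrations [F]; by [cofibration_model_structure] below, these two classes
    determine the third one. *)
Definition cofibration (C : category) (W F : morphism_class C) :
    morphism_class C :=
  fun A B i => forall (E B' : C) (p : hom E B'),
    trivial_fibration W F p -> has_lifting i p.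

Definition cofibrant (C : category) (W F : morphism_class C)
    (O : initial_object C) (A : C) :=
  cofibration W F (from_initial O A).

Record model_structure (C : category) (W F Cof : morphism_class C) : Prop := {
  weq_compm : forall (A B D : C) (f : hom A B) (g : hom B D),
    W _ _ f -> W _ _ g -> W _ _ (compm g f);
  weq_cancell : forall (A B D : C) (f : hom A B) (g : hom B D),
    W _ _ g -> W _ _ (compm g f) -> W _ _ f;
  weq_cancelr : forall (A B D : C) (f : hom A B) (g : hom B D),
    W _ _ f -> W _ _ (compm g f) -> W _ _ g;
  weq_retract : forall (A B A' B' : C) (f : hom A B) (g : hom A' B'),
    is_retract f g -> W _ _ g -> W _ _ f;
  fib_retract : forall (A B A' B' : C) (f : hom A B) (g : hom A' B'),
    is_retract f g -> F _ _ g -> F _ _ f;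
  cof_retract : forall (A B A' B' : C) (f : hom A B) (g : hom A' B'),
    is_retract f g -> Cof _ _ g -> Cof _ _ f;
  cof_lift : forall (A B E D : C) (i : hom A B) (p : hom E D),
    Cof _ _ i -> W _ _ p -> F _ _ p -> has_lifting i p;
  tcof_lift : forall (A B E D : C) (i : hom A B) (p : hom E D),
    Cof _ _ i -> W _ _ i -> F _ _ p -> has_lifting i p;
  cof_tfib_factor : forall (A B : C) (f : hom A B),
    exists (E : C) (i : hom A E) (p : hom E B),
      [/\ f = compm p i, Cof _ _ i, W _ _ p & F _ _ p];
  tcof_fib_factor : forall (A B : C) (f : hom A B),
    exists (E : C) (i : hom A E) (p : hom E B),
      [/\ f = compm p i, Cof _ _ i, W _ _ i & F _ _ p]
}.

Lemma cofibration_model_structure (C : category) (W F Cof : morphism_class C) :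
  model_structure W F Cof ->
  forall (A B : C) (i : hom A B), Cof A B i <-> cofibration W F i.
Proof.
move=> M A B i; split=> [ci E B' p [Wp Fp]|ci]; first exact: (cof_lift M).
have [E [j [p [ipj cj Wp Fp]]]] := cof_tfib_factor M i.
have [||h [hij phi]] := ci E B p _ j (idm B); first by split.
  by rewrite comp1m.
apply: (cof_retract M) cj; exists (idm A), (idm A), h, p.
by split; rewrite ?compm1 ?comp1m.
Qed.

(** The functorial factorisation of [initial -> A] as a cofibration followed by
    a trivial fibration: the middle object is a functor [Q] of [A], and the
    second factor is natural in [A]. *)
Record cofibrant_replacement (C : category) (W F : morphism_class C)
    (O : initial_object C) := CofibrantReplacement {
  crep :> functor C C;
  crep_map : forall A : C, hom (crep A) A;
  crep_natural : forall (A B : C) (f : hom A B),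
    compm (crep_map B) (fhom crep f) = compm f (crep_map A);
  crep_cofibrant : forall A : C, cofibrant W F O (crep A);
  crep_tfib : forall A : C, trivial_fibration W F (crep_map A)
}.

(** * Compactly generated spaces *)

Definition compact_hausdorff (K : topologicalType) :=
  compact [set: K] /\ hausdorff_space K.

Definition k_open (T : topologicalType) (U : set T) :=
  forall K : topologicalType, compact_hausdorff K ->
    forall u : continuousType K T, open (u @^-1` U).

HB.mixin Record isCompactlyGenerated T & Topological T := {
  k_spaceP : forall U : set T, k_open U -> open U;
  weak_hausdorffP : forall K : topologicalType, compact_hausdorff K ->
    forall u : continuousType K T, closed (range u)
}.

#[short(type="cgType")]
HB.structure Definition CompactlyGenerated :=
  {T of isCompactlyGenerated T & Topological T}.

Definition kification (T : Type) : Type := T.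

Section kification.
Variable T : topologicalType.

Lemma k_openT : k_open [set: T].
Proof. by move=> K _ u; rewrite preimage_setT; exact: openT. Qed.

Lemma k_openI : setI_closed (@k_open T).
Proof.
move=> U V kU kV K cK u; rewrite preimage_setI.
by apply: openI; [exact: kU|exact: kV].
Qed.

Lemma k_open_bigU (I : Type) (f : I -> set T) :
  (forall i, k_open (f i)) -> k_open (\bigcup_i f i).
Proof.
move=> kf K cK u; rewrite preimage_bigcup.
by apply: bigcup_open => i _; exact: kf.
Qed.

HB.instance Definition _ := Choice.copy (kification T) T.
HB.instance Definition _ :=
  isOpenTopological.Build (kification T) k_openT k_openI k_open_bigU.

End kification.

Section discrete_cg.
Variable T : choiceType.

Lemma discrete_k_space (U : set (discrete_topology T)) : k_open U -> open U.
Proof. by move=> _; exact: discrete_open. Qed.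

Lemma discrete_weak_hausdorff (K : topologicalType) : compact_hausdorff K ->
  forall u : continuousType K (discrete_topology T), closed (range u).
Proof. by move=> _ u; exact: discrete_closed. Qed.

HB.instance Definition _ := isCompactlyGenerated.Build (discrete_topology T)
  discrete_k_space discrete_weak_hausdorff.

End discrete_cg.

Definition ctsid (X : topologicalType) : continuousType X X := idfun.

Definition ctscomp (X Y Z : topologicalType) (g : continuousType Y Z)
  (f : continuousType X Y) : continuousType X Z := g \o f.

Definition Top : category.
Proof.
apply: (@Category cgType (fun X Y => continuousType X Y)
  (fun X => ctsid X) (fun X Y Z => @ctscomp X Y Z)).
- by move=> X Y f; apply/continuousEP.
- by move=> X Y f; apply/continuousEP.
- by move=> X Y Z T f g h; apply/continuousEP.
Defined.

Definition empty_space : cgType := discrete_topology void.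

Lemma empty_map_continuous (X : topologicalType) :
  continuous (fun v : discrete_topology void => of_void X v).
Proof. by case. Qed.

Definition empty_map (X : topologicalType) :
  continuousType (discrete_topology void) X := mkcts (@empty_map_continuous X).

Lemma empty_map_uniq (X : topologicalType)
  (f : continuousType (discrete_topology void) X) : f = empty_map X.
Proof. by apply/continuousEP; case. Qed.

Definition empty_Top : initial_object Top :=
  @InitialObject Top empty_space (fun X : cgType => empty_map X)
    (fun X : cgType => @empty_map_uniq X).

(** * Homotopy *)

Section homotopy.
Variable R : realType.

Definition unit_interval : topologicalType := set_type `[0%R : R, 1%R]%classic.

Lemma unit_interval_proof0 : (0%R : R) \in `[0%R : R, 1%R]%classic.
Proof. by rewrite inE /= in_itv /= lexx ler01. Qed.

Lemma unit_interval_proof1 : (1%R : R) \in `[0%R : R, 1%R]%classic.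
Proof. by rewrite inE /= in_itv /= lexx ler01. Qed.

Definition itv0 : unit_interval := exist _ 0%R unit_interval_proof0.
Definition itv1 : unit_interval := exist _ 1%R unit_interval_proof1.

Definition cube (n : nat) : topologicalType := {ptws 'I_n -> unit_interval}.

Definition cube_boundary (n : nat) : set (cube n) :=
  [set v | exists i, v i = itv0 \/ v i = itv1].

(** The product with the interval is the ordinary one: since the interval is
    compact Hausdorff, it agrees with the product of compactly generated
    spaces. *)
Definition homotopic_rel (X Y : topologicalType) (A : set X)
    (f g : continuousType X Y) :=
  exists H : continuousType (X * unit_interval)%type Y,
    [/\ forall x, H (x, itv0) = f x,
        forall x, H (x, itv1) = g x &
        forall x t, A x -> H (x, t) = f x].

Definition homotopic (X Y : topologicalType) (f g : continuousType X Y) :=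
  homotopic_rel set0 f g.

Definition homotopy_equivalence (X Y : topologicalType)
    (f : continuousType X Y) :=
  exists g : continuousType Y X,
    homotopic (ctscomp g f) (ctsid X) /\ homotopic (ctscomp f g) (ctsid Y).

Definition path_connected_points (X : topologicalType) (x y : X) :=
  exists c : continuousType unit_interval X, c itv0 = x /\ c itv1 = y.

(** Elements of the [n]-th homotopy group at [x] are represented by maps of the
    [n]-cube sending the boundary to [x], up to homotopy relative to the
    boundary. *)
Definition based_cube (X : topologicalType) (n : nat) (x : X)
    (a : continuousType (cube n) X) :=
  forall v, cube_boundary v -> a v = x.

Definition pi0_injective (X Y : topologicalType) (f : continuousType X Y) :=
  forall x y : X,
    path_connected_points (f x) (f y) -> path_connected_points x y.

Definition pi0_surjective (X Y : topologicalType) (f : continuousType X Y) :=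
  forall y : Y, exists x : X, path_connected_points (f x) y.

Definition pi_injective (X Y : topologicalType) (f : continuousType X Y)
    (n : nat) (x : X) :=
  forall a b : continuousType (cube n) X,
    based_cube x a -> based_cube x b ->
    homotopic_rel (@cube_boundary n) (ctscomp f a) (ctscomp f b) ->
    homotopic_rel (@cube_boundary n) a b.

Definition pi_surjective (X Y : topologicalType) (f : continuousType X Y)
    (n : nat) (x : X) :=
  forall c : continuousType (cube n) Y, based_cube (f x) c ->
    exists2 a : continuousType (cube n) X,
      based_cube x a & homotopic_rel (@cube_boundary n) (ctscomp f a) c.

(** The maps induced on homotopy groups being morphisms of groups, they are
    isomorphisms as soon as they are bijective. *)
Definition weak_homotopy_equivalence (X Y : topologicalType)
    (f : continuousType X Y) :=
  [/\ pi0_injective f, pi0_surjective f &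
      forall (n : nat) (x : X), pi_injective f n.+1 x /\ pi_surjective f n.+1 x].

Definition serre_fibration (E B : topologicalType) (p : continuousType E B) :=
  forall (n : nat) (a : continuousType (cube n) E)
      (h : continuousType (cube n * unit_interval)%type B),
    (forall v, p (a v) = h (v, itv0)) ->
    exists H : continuousType (cube n * unit_interval)%type E,
      (forall v, H (v, itv0) = a v) /\ (forall w, p (H w) = h w).

Definition Top_weq : morphism_class Top :=
  fun X Y f => weak_homotopy_equivalence f.

Definition Top_fib : morphism_class Top :=
  fun X Y f => serre_fibration f.

Definition cofibrant_space (X : cgType) :=
  @cofibrant Top Top_weq Top_fib empty_Top X.

End homotopy.

(** * Flows *)

(** The set of composable pairs is topologised as a subspace of the product of
    compactly generated spaces; [src] and [tgt] being locally constant, it is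
    open and closed in it, so that no further k-ification is needed. *)
Definition composable (P : cgType) (S : discreteTopologicalType)
    (s t : P -> S) : set (kification (P * P)) :=
  [set p | t p.1 = s p.2].

Record flow := Flow {
  path_space : cgType;
  state : discreteTopologicalType;
  src : continuousType path_space state;
  tgt : continuousType path_space state;
  comp_path : forall x y : path_space, tgt x = src y -> path_space;
  comp_path_continuous :
    continuous (fun p : set_type (composable src tgt) =>
      comp_path (set_valP p));
  src_comp : forall x y (xy : tgt x = src y), src (comp_path xy) = src x;
  tgt_comp : forall x y (xy : tgt x = src y), tgt (comp_path xy) = tgt y;
  comp_pathA : forall x y z (xy : tgt x = src y) (yz : tgt y = src z)
      (xy_z : tgt (comp_path xy) = src z) (x_yz : tgt x = src (comp_path yz)),
    comp_path xy_z = comp_path x_yz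
}.

Arguments src {_}.
Arguments tgt {_}.

Record flow_hom (X Y : flow) := FlowHom {
  on_state : state X -> state Y;
  on_path : continuousType (path_space X) (path_space Y);
  src_hom : forall x, src (on_path x) = on_state (src x);
  tgt_hom : forall x, tgt (on_path x) = on_state (tgt x);
  hom_comp_path : forall x y (xy : tgt x = src y)
      (fxy : tgt (on_path x) = src (on_path y)),
    on_path (comp_path xy) = comp_path fxy
}.

Lemma flow_homP (X Y : flow) (f g : flow_hom X Y) :
  on_state f =1 on_state g -> on_path f =1 on_path g -> f = g.
Proof.
case: f g => [f0 Pf fs ft fc] [g0 Pg gs gt gc] /= /funext fg0 /continuousEP Pfg.
by subst; congr FlowHom; exact: Prop_irrelevance.
Qed.

Lemma composable_hom (X Y : flow) (f : flow_hom X Y) (x y : path_space X) :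
  tgt x = src y -> tgt (on_path f x) = src (on_path f y).
Proof. by move=> xy; rewrite tgt_hom src_hom xy. Qed.

Definition flow_id (X : flow) : flow_hom X X.
Proof.
apply: (@FlowHom X X id (ctsid (path_space X))) => // x y xy fxy /=.
by congr comp_path; exact: Prop_irrelevance.
Defined.

Definition flow_comp (X Y Z : flow) (g : flow_hom Y Z) (f : flow_hom X Y) :
  flow_hom X Z.
Proof.
apply: (@FlowHom X Z (on_state g \o on_state f)
  (ctscomp (on_path g) (on_path f))).
- by move=> x /=; rewrite !src_hom.
- by move=> x /=; rewrite !tgt_hom.
- move=> x y xy fxy /=.
  by rewrite (hom_comp_path xy (composable_hom f xy)) (hom_comp_path _ fxy).
Defined.

Definition Flows : category.
Proof.
apply: (@Category flow flow_hom flow_id flow_comp).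
- by move=> X Y f; apply: flow_homP.
- by move=> X Y f; apply: flow_homP.
- by move=> X Y Z T f g h; apply: flow_homP.
Defined.

Definition empty_flow : flow.
Proof.
apply: (@Flow empty_space (discrete_topology void) (ctsid _) (ctsid _)
  (fun x y _ => x)); try by case.
by case=> -[[]].
Defined.

Definition from_empty_flow (X : flow) : flow_hom empty_flow X.
Proof.
by apply: (@FlowHom empty_flow X (empty_map (state X))
  (empty_map (path_space X))); case.
Defined.

Lemma from_empty_flow_uniq (X : flow) (f : flow_hom empty_flow X) :
  f = from_empty_flow X.
Proof. by apply: flow_homP; case. Qed.

Definition empty_Flow : initial_object Flows :=
  @InitialObject Flows empty_flow from_empty_flow from_empty_flow_uniq.

Definition weak_S_homotopy_equivalence (R : realType) (X Y : flow)
    (f : flow_hom X Y) :=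
  bijective (on_state f) /\ weak_homotopy_equivalence R (on_path f).

Definition Flow_weq (R : realType) : morphism_class Flows :=
  fun X Y f => weak_S_homotopy_equivalence R f.

Definition Flow_fib (R : realType) : morphism_class Flows :=
  fun X Y f => serre_fibration R (on_path f).

Definition flow_cofibrant_replacement (R : realType) :=
  cofibrant_replacement (Flow_weq R) (Flow_fib R) empty_Flow.

(** * Branching spaces *)

Definition branching_invariant (X : flow) (Z : topologicalType)
    (phi : path_space X -> Z) :=
  forall x y (xy : tgt x = src y), phi x = phi (comp_path xy).

Record branching_space (X : flow) := BranchingSpace {
  branching : cgType;
  branching_proj : continuousType (path_space X) branching;
  branching_projP : branching_invariant branching_proj;
  branching_universal : forall (Z : cgType)
      (phi : continuousType (path_space X) Z), branching_invariant phi ->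
    exists! psi : continuousType branching Z,
      forall x, psi (branching_proj x) = phi x
}.

Section branching_map.
Variables (X Y : flow) (BX : branching_space X) (BY : branching_space Y).
Variable f : flow_hom X Y.

Lemma branching_map_invariant :
  branching_invariant (ctscomp (branching_proj BY) (on_path f)).
Proof.
move=> x y xy /=; rewrite (hom_comp_path xy (composable_hom f xy)).
exact: branching_projP.
Qed.

Definition branching_map : continuousType (branching BX) (branching BY) :=
  projT1 (cid (branching_universal BX branching_map_invariant)).

Lemma branching_mapE (x : path_space X) :
  branching_map (branching_proj BX x) = branching_proj BY (on_path f x).
Proof.
by rewrite /branching_map; case: cid => psi [/= psiE _]; exact: psiE.
Qed.

End branching_map.

Section ho_branching.
Variables (R : realType) (Q : flow_cofibrant_replacement R).
Variable Pm : forall X : flow, branching_space X.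

Definition ho_branching (X : flow) : cgType := branching (Pm (Q X)).

Definition ho_branching_map (X Y : flow) (f : flow_hom X Y) :
    continuousType (ho_branching X) (ho_branching Y) :=
  branching_map (Pm (Q X)) (Pm (Q Y)) (fhom Q (f : hom (X : Flows) Y)).

End ho_branching.

(* Main.v *)
(** The branching space functor is left adjoint to the functor sending a space
    [Z] to the one-state flow with path space [Z] and [x * y = x]; the latter
    preserves trivial fibrations, so the branching space of a cofibrant flow is
    cofibrant.

    For the homotopy equivalence, let [g : A -> B] be a weak S-homotopy
    equivalence with [B] cofibrant.  The pairs of a path [a] of [A] and a map
    from the interval to the path space of [B] starting at [g a] form a flow
    with the states of [A], and evaluation at the other end is a trivial
    fibration onto [B].  A section of it is a map [r : B -> A] with a homotopy
    of flows from [g r] to the identity, and [r] is again a weak S-homotopy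
    equivalence.  If [A] is cofibrant too, [r] has in turn a right homotopy
    inverse.  The branching space functor preserves these homotopies, so it
    sends [g] to a homotopy equivalence.  Changes of base point are absorbed by
    the homotopy extension property of cubes. *)

Require Import Defs.
From HB Require Import structures.
From mathcomp Require Import all_boot all_order all_algebra.
From mathcomp Require Import all_classical all_reals topology.
From mathcomp Require Import normedtype.
From mathcomp Require Import lra ring.

Set Implicit Arguments.
Unset Strict Implicit.
Unset Printing Implicit Defensive.

Import Order.TTheory GRing.Theory Num.Theory numFieldTopology.Exports.

Local Open Scope classical_set_scope.
Local Open Scope ring_scope.

(** * The unit interval *)

Lemma set_type_continuous (T X : topologicalType) (A : set X)
    (f : T -> set_type A) :
  continuous (fun t => set_val (f t)) -> continuous f.
Proof.
by move=> /continuousP cf; apply/continuousP => _ [V oV <-]; exact: (cf V oV).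
Qed.

Lemma set_val_continuous (X : topologicalType) (A : set X) :
  continuous (@set_val X A).
Proof. exact: initial_continuous. Qed.

Lemma pair_continuous (T X Y : topologicalType) (f : T -> X) (g : T -> Y) :
  continuous f -> continuous g -> continuous (fun t => (f t, g t)).
Proof. by move=> cf cg t; apply: cvg_pair; [exact: cf|exact: cg]. Qed.

Lemma comp_continuous (X Y Z : topologicalType) (f : X -> Y) (g : Y -> Z) :
  continuous f -> continuous g -> continuous (fun x => g (f x)).
Proof. by move=> cf cg x; apply: continuous_comp; [exact: cf|exact: cg]. Qed.

Lemma fst_continuous (X Y : topologicalType) : continuous (@fst X Y).
Proof. by move=> ?; exact: cvg_fst. Qed.

Lemma snd_continuous (X Y : topologicalType) : continuous (@snd X Y).
Proof. by move=> ?; exact: cvg_snd. Qed.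

Lemma cst_continuous_fun (X Y : topologicalType) (y : Y) :
  continuous (fun _ : X => y).
Proof. by move=> ?; exact: cvg_cst. Qed.

Lemma id_continuous_fun (X : topologicalType) : continuous (fun x : X => x).
Proof. by move=> ?; exact: cvg_id. Qed.

Lemma continuous_preimage_open (X Y : topologicalType) (f : X -> Y) (D : set Y) :
  continuous f -> open D -> open (f @^-1` D).
Proof. by move/continuousP; exact. Qed.

Lemma continuous_preimage_closed (X Y : topologicalType) (f : X -> Y)
  (D : set Y) : continuous f -> closed D -> closed (f @^-1` D).
Proof. by move/continuous_closedP; exact. Qed.

Definition cts_of (X Y : topologicalType) (f : X -> Y) (cf : continuous f) :
  continuousType X Y := mkcts cf.

Lemma cts_ofE (X Y : topologicalType) (f : X -> Y) (cf : continuous f) x :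
  cts_of cf x = f x.
Proof. by []. Qed.

(** The [C i] cut the preimage of a closed set into finitely many closed pieces. Maps defined by
    cases, such as concatenated homotopies and box fillings, get their continuity from here. *)
Lemma pasting_continuous (X Y : topologicalType) (n : nat)
    (C : 'I_n -> set X) (g : 'I_n -> X -> Y) (f : X -> Y) :
  (forall i, closed (C i)) -> (forall i, continuous (g i)) ->
  (forall x, exists i, C i x) -> (forall i x, C i x -> f x = g i x) ->
  continuous f.
Proof.
move=> cC cg cover fg; apply/continuous_closedP => D cD.
have -> : f @^-1` D = \bigcup_(i in [set: 'I_n]) (C i `&` g i @^-1` D).
  apply/seteqP; split=> x /=.
    by move=> Dfx; have [i Cx] := cover x; exists i => //; rewrite /= -fg.
  by move=> [i _ [Cx]] /=; rewrite -fg.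
apply: closed_bigcup => [|i _]; first exact: finite_finset.
apply: closedI => //.
by move/continuous_closedP: (cg i); exact.
Qed.

Section interval.
Variable R : realType.
Local Notation I := (unit_interval R).
Local Notation i0 := (itv0 R).
Local Notation i1 := (itv1 R).

Definition ival : I -> R := set_val.

Lemma ival_continuous : continuous ival.
Proof. exact: set_val_continuous. Qed.

Lemma ival_inj : injective ival.
Proof. exact: val_inj. Qed.

Lemma ival_ge0 (t : I) : 0 <= ival t.
Proof. by have := set_valP t; rewrite /= in_itv /= => /andP[]. Qed.

Lemma ival_le1 (t : I) : ival t <= 1.
Proof. by have := set_valP t; rewrite /= in_itv /= => /andP[]. Qed.

Lemma iclamp_proof (x : R) :
  (Num.max 0 (Num.min 1 x) : R) \in `[0 : R, 1]%classic.
Proof.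
by rewrite inE /= in_itv /= le_max lexx /= ge_max ler01 ge_min lexx.
Qed.

(** The retraction of the line onto the interval. Points of the interval can then be given by real
    formulas, with bounds checked only where the exact value matters. *)
Definition iclamp (x : R) : I :=
  exist _ (Num.max 0 (Num.min 1 x)) (iclamp_proof x).

Lemma ival_iclamp (x : R) : ival (iclamp x) = Num.max 0 (Num.min 1 x).
Proof. by []. Qed.

Lemma ival_iclampT (x : R) : 0 <= x <= 1 -> ival (iclamp x) = x.
Proof. by case/andP=> x0 x1; rewrite ival_iclamp min_r // max_r. Qed.

Lemma iclamp_le0 (x : R) : x <= 0 -> iclamp x = i0.
Proof.
move=> x0; apply: ival_inj; rewrite ival_iclamp max_l //.
by rewrite ge_min x0 orbT.
Qed.

Lemma iclamp_ge1 (x : R) : 1 <= x -> iclamp x = i1.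
Proof. by move=> x1; apply: ival_inj; rewrite ival_iclamp min_l // max_r. Qed.

Lemma ivalK : cancel ival iclamp.
Proof.
by move=> t; apply: ival_inj; rewrite ival_iclampT // ival_ge0 ival_le1.
Qed.

Lemma ival0 : ival i0 = 0. Proof. by []. Qed.
Lemma ival1 : ival i1 = 1. Proof. by []. Qed.

Lemma iclamp_continuous : continuous iclamp.
Proof.
apply: set_type_continuous.
have c1 (x : R^o) : {for x, continuous ((fun=> 1) \min id : R^o -> R^o)}.
  by apply: continuous_min; [exact: cvg_cst|exact: cvg_id].
by move=> x; apply: (@continuous_max R R^o (fun=> 0) ((fun=> 1) \min id));
  [exact: cvg_cst|exact: c1].
Qed.

Lemma interval_compact : compact [set: I].
Proof.
have -> : [set: I] = iclamp @` `[0, 1]%classic.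
  apply/seteqP; split=> // t _; exists (ival t); last exact: ivalK.
  exact: set_valP.
apply: continuous_compact; last exact: segment_compact.
by apply: continuous_subspaceT => x; exact: iclamp_continuous.
Qed.

Lemma interval_hausdorff : hausdorff_space I.
Proof.
move=> s t st; apply: ival_inj; apply: (@order_hausdorff _ R) => A B nA nB.
have [||u [Au Bu]] := st (ival @^-1` A) (ival @^-1` B).
- exact: ival_continuous.
- exact: ival_continuous.
- by exists (ival u).
Qed.

Lemma interval_CH : compact_hausdorff I.
Proof. by split; [exact: interval_compact|exact: interval_hausdorff]. Qed.

(** Point preimages under a map to a discrete space are clopen. This is what makes sources and
    targets constant along a path in a path space. *)
Lemma interval_connected (T : discreteTopologicalType) (f : I -> T) :
  continuous f -> forall s t, f s = f t.
Proof.
move=> cf s t.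
have cI : connected [set: I].
  have -> : [set: I] = iclamp @` `[0, 1]%classic.
    apply/seteqP; split=> // u _; exists (ival u); last exact: ivalK.
    exact: set_valP.
  apply: connected_continuous_connected; first exact: segment_connected.
  by apply: continuous_subspaceT => x; exact: iclamp_continuous.
suff E : f @^-1` [set f t] = setT.
  by have : (f @^-1` [set f t]) s by rewrite E.
apply: cI; first by exists t.
- exists (f @^-1` [set f t]); last by rewrite setTI.
  by move/continuousP: cf; apply; exact: discrete_open.
- exists (f @^-1` [set f t]); last by rewrite setTI.
  by move/continuous_closedP: cf; apply; exact: discrete_closed.
Qed.

End interval.

(** * Homotopies and two out of three *)

Section real_maps.
Variables (R : realType) (T : topologicalType) (f g : T -> R).
Hypotheses (cf : continuous f) (cg : continuous g).

Lemma addr_continuous : continuous (fun t => f t + g t).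
Proof. by move=> t; apply: (@cvgD R R^o); [exact: cf|exact: cg]. Qed.

Lemma oppr_continuous : continuous (fun t => - f t).
Proof. by move=> t; apply: (@cvgN R R^o); exact: cf. Qed.

Lemma mulr_continuous : continuous (fun t => f t * g t).
Proof. by move=> t; apply: (@cvgM R); [exact: cf|exact: cg]. Qed.

Lemma maxr_continuous : continuous (fun t => Num.max (f t) (g t)).
Proof.
by move=> t; apply: (@continuous_max R T f g); [exact: cf|exact: cg].
Qed.

Lemma normr_continuous : continuous (fun t => `|f t|).
Proof. by move=> t; apply: (@cvg_norm R R^o); exact: cf. Qed.

Lemma invr_continuous : (forall t, f t != 0) -> continuous (fun t => (f t)^-1).
Proof. by move=> f0 t; apply: (@cvgV R); [exact: f0|exact: cf]. Qed.

End real_maps.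

(** [type of] fails on an open term, that is, when [f] is not constant. *)
Ltac is_cst f :=
  lazymatch f with fun x => ?y => let T := type of y in idtac | _ => fail end.

(** Proves continuity by descending through the outermost operation of the map; maps that it does
    not recognise are left as goals. Constants are tested first because they would also match the
    patterns for operations. *)
Ltac cts :=
  lazymatch goal with
  | |- forall x, continuous_at x ?f =>
    tryif is_cst f then exact: cst_continuous_fun else cts_step f
  | |- _ => idtac
  end
with cts_step f :=
  lazymatch f with
  | fun x => (@?g x, @?h x) => apply: (pair_continuous (f := g) (g := h)); cts
  | fun x => @?g x + @?h x => apply: (addr_continuous (f := g) (g := h)); cts
  | fun x => - @?g x => apply: (oppr_continuous (f := g)); cts
  | fun x => @?g x * @?h x => apply: (mulr_continuous (f := g) (g := h)); cts
  | fun x => Num.max (@?g x) (@?h x) =>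
      apply: (maxr_continuous (f := g) (g := h)); cts
  | fun x => `|@?g x| => apply: (normr_continuous (f := g)); cts
  | fun x => x => exact: id_continuous_fun
  | fun x => ival x => exact: ival_continuous
  | fun x => iclamp x => exact: iclamp_continuous
  | fun x => fst x => exact: fst_continuous
  | fun x => snd x => exact: snd_continuous
  | fun x => Continuous.sort ?k x => exact: cts_fun
  | fun x => ival (@?g x) =>
      apply: (comp_continuous (f := g) (g := @ival _)); cts
  | fun x => iclamp (@?g x) =>
      apply: (comp_continuous (f := g) (g := @iclamp _)); cts
  | fun x => fst (@?g x) => apply: (comp_continuous (f := g) (g := fst)); cts
  | fun x => snd (@?g x) => apply: (comp_continuous (f := g) (g := snd)); cts
  | fun x => ?k (@?g x) => 
      tryif apply: (comp_continuous (f := g) (g := k)) then cts else idtac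
  | @fst _ _ => exact: fst_continuous
  | @snd _ _ => exact: snd_continuous
  | @ival _ => exact: ival_continuous
  | @iclamp _ => exact: iclamp_continuous
  | Continuous.sort _ => exact: cts_fun
  | _ => try assumption
  end.

Section concatenation.
Variable R : realType.
Local Notation I := (unit_interval R).
Local Notation i0 := (itv0 R).
Local Notation i1 := (itv1 R).

Lemma real_closed_le (T : topologicalType) (f g : T -> R) :
  continuous f -> continuous g -> closed [set t | f t <= g t].
Proof.
move=> cf cg.
have -> : [set t | f t <= g t] = (fun t => g t - f t) @^-1` [set x | 0 <= x].
  by apply/seteqP; split=> t /=; rewrite subr_ge0.
apply: continuous_preimage_closed; last exact: closed_ge.
by apply: addr_continuous => //; exact: oppr_continuous.
Qed.

Definition concat (X : Type) (Y : Type) (F G : X * I -> Y) (z : X * I) : Y :=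
  if ival z.2 <= 2^-1 then F (z.1, iclamp (2 * ival z.2))
  else G (z.1, iclamp (2 * ival z.2 - 1)).

Lemma concat_continuous (X Y : topologicalType) (F G : X * I -> Y) :
  continuous F -> continuous G -> (forall x, F (x, i1) = G (x, i0)) ->
  continuous (concat F G).
Proof.
move=> cF cG FG.
apply: (@pasting_continuous _ _ 2
  (fun i z => if i == ord0 then ival z.2 <= 2^-1 else 2^-1 <= ival z.2)
  (fun i z => if i == ord0 then F (z.1, iclamp (2 * ival z.2))
     else G (z.1, iclamp (2 * ival z.2 - 1)))).
- by move=> i; case: (i == ord0) => /=; apply: real_closed_le; cts.
- by move=> i; case: (i == ord0) => /=; cts.
- move=> z; have [z1|/ltW z1] := leP (ival z.2) (2^-1).
    by exists ord0.
  by exists ord_max.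
- move=> i z; case: (i == ord0) => zi; rewrite /concat; first by rewrite zi.
  case: ifP => // zi'.
  have -> : ival z.2 = 2^-1 by apply/eqP; rewrite eq_le zi zi'.
  by rewrite iclamp_ge1 ?iclamp_le0 ?FG //; lra.
Qed.

Lemma concat0 (X Y : Type) (F G : X * I -> Y) x :
  concat F G (x, i0) = F (x, i0).
Proof. by rewrite /concat /= ival0 invr_ge0 ler0n mulr0 iclamp_le0. Qed.

Lemma concat1 (X Y : Type) (F G : X * I -> Y) x :
  concat F G (x, i1) = G (x, i1).
Proof.
rewrite /concat /= ival1; case: ifP => [h|_]; first by exfalso; lra.
by rewrite iclamp_ge1 //; lra.
Qed.

Lemma concat_ind (X Y : Type) (F G : X * I -> Y) (P : Y -> Prop) x t :
  (forall s, P (F (x, s))) -> (forall s, P (G (x, s))) -> P (concat F G (x, t)).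
Proof. by move=> PF PG; rewrite /concat; case: ifP. Qed.

Definition irev (t : I) : I := iclamp (1 - ival t).

Lemma irev_continuous : continuous irev.
Proof. by rewrite /irev; cts. Qed.

Lemma irev0 : irev i0 = i1.
Proof. by rewrite /irev ival0 subr0 iclamp_ge1. Qed.

Lemma irev1 : irev i1 = i0.
Proof. by rewrite /irev ival1 subrr iclamp_le0. Qed.

Lemma homotopic_refl (X Y : topologicalType) (A : set X)
  (f : continuousType X Y) : homotopic_rel R A f f.
Proof.
have c : continuous (fun z : X * I => f z.1) by cts.
by exists (cts_of c).
Qed.

Lemma homotopic_sym (X Y : topologicalType) (A : set X)
  (f g : continuousType X Y) : homotopic_rel R A f g -> homotopic_rel R A g f.
Proof.
move=> [H [H0 H1 HA]].
have c : continuous (fun z : X * I => H (z.1, irev z.2)).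
  by cts; exact: irev_continuous.
exists (cts_of c); split=> [x|x|x t Ax]; rewrite ?cts_ofE /=.
- by rewrite irev0.
- by rewrite irev1.
(* On [A] the reversed homotopy rests at [f x], which equals [g x] because [H] ends at [g]. *)
- by rewrite HA // -H1 HA.
Qed.

Lemma homotopic_trans (X Y : topologicalType) (A : set X)
  (f g h : continuousType X Y) : homotopic_rel R A f g ->
  homotopic_rel R A g h -> homotopic_rel R A f h.
Proof.
move=> [H [H0 H1 HA]] [K [K0 K1 KA]].
have c : continuous (concat H K).
  apply: concat_continuous; [exact: cts_fun|exact: cts_fun|].
  by move=> x; rewrite H1 K0.
exists (cts_of c); split=> [x|x|x t Ax]; rewrite ?cts_ofE /=.
- by rewrite concat0.
- by rewrite concat1.
- have gf : g x = f x by rewrite -H1 HA.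
  apply: (@concat_ind X Y H K (fun y => y = f x)) => s; first exact: HA.
  by rewrite KA.
Qed.

Lemma homotopic_post (X Y Z : topologicalType) (A : set X)
  (f g : continuousType X Y) (k : continuousType Y Z) :
  homotopic_rel R A f g -> homotopic_rel R A (ctscomp k f) (ctscomp k g).
Proof.
move=> [H [H0 H1 HA]].
exists (ctscomp k H); split=> [x|x|x t Ax] /=.
- by rewrite H0.
- by rewrite H1.
- by rewrite HA.
Qed.

Lemma homotopic_pre (X Y Z : topologicalType)
  (f g : continuousType Y Z) (k : continuousType X Y) :
  homotopic R f g -> homotopic R (ctscomp f k) (ctscomp g k).
Proof.
move=> [H [H0 H1 HA]].
have c : continuous (fun z : X * I => H (k z.1, z.2)) by cts.
exists (cts_of c); split=> [x|x|//]; rewrite ?cts_ofE /=.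
- by rewrite H0.
- by rewrite H1.
Qed.

Lemma path_sym (X : topologicalType) (x y : X) :
  path_connected_points R x y -> path_connected_points R y x.
Proof.
move=> [c [c0 c1]].
have cc : continuous (fun t => c (irev t)) by cts; exact: irev_continuous.
by exists (cts_of cc); rewrite ?cts_ofE /= irev0 irev1.
Qed.

Lemma path_trans (X : topologicalType) (x y z : X) :
  path_connected_points R x y -> path_connected_points R y z ->
  path_connected_points R x z.
Proof.
move=> [c [c0 c1]] [d [d0 d1]].
(* [concat] acts on homotopies, so each path is given a dummy first coordinate. *)
pose F (w : I * I) := c w.2; pose G (w : I * I) := d w.2.
have cFG : continuous (concat F G).
  apply: concat_continuous; rewrite /F /G; [by cts|by cts|].
  by move=> _ /=; rewrite c1 d0.
have cc : continuous (fun t => concat F G (i0, t)) by cts.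
by exists (cts_of cc); rewrite ?cts_ofE /= concat0 concat1.
Qed.

Lemma path_map (X Y : topologicalType) (f : continuousType X Y) (x y : X) :
  path_connected_points R x y -> path_connected_points R (f x) (f y).
Proof. by move=> [c [<- <-]]; exists (ctscomp f c). Qed.

End concatenation.

(** * Composition and cancellation of weak homotopy equivalences *)

Section two_out_of_three.
Variables (R : realType) (X Y Z : topologicalType).
Variables (f : continuousType X Y) (g : continuousType Y Z).

Lemma weak_homotopy_equivalence_comp :
  weak_homotopy_equivalence R f -> weak_homotopy_equivalence R g ->
  weak_homotopy_equivalence R (ctscomp g f).
Proof.
move=> [fi fs fn] [gi gs gn]; split.
- by move=> x y /gi /fi.
- move=> z; have [y yz] := gs z; have [x xy] := fs y; exists x.
  by apply: path_trans yz; exact: (path_map g).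
- move=> n x; have [fni fns] := fn n x; have [gni gns] := gn n (f x); split.
    move=> a b ax bx gfab; apply: fni => //.
    have E (c : continuousType (cube R n.+1) X) :
      ctscomp (ctscomp g f) c = ctscomp g (ctscomp f c) by apply/continuousEP.
    move: gfab; rewrite !E; apply: gni.
      by move=> v bv /=; rewrite ax.
    by move=> v bv /=; rewrite bx.
  move=> c cx; have [b bx gbc] := gns c cx; have [a ax fab] := fns b bx.
  exists a => //; apply: homotopic_trans gbc.
  have -> : ctscomp (ctscomp g f) a = ctscomp g (ctscomp f a).
    exact/continuousEP.
  exact: homotopic_post.
Qed.

(** Here [g] is only ever needed at base points [f x], so the argument is formal: no change of base
    point occurs. *)
Lemma weak_homotopy_equivalence_cancel :
  weak_homotopy_equivalence R g -> weak_homotopy_equivalence R (ctscomp g f) ->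
  weak_homotopy_equivalence R f.
Proof.
move=> [gi gs gn] [hi hs hn]; split.
- by move=> x y xy; apply: hi => /=; exact: path_map.
- by move=> y; have [x xy] := hs (g y); exists x; exact: gi.
- move=> n x; have [hni hns] := hn n x; have [gni gns] := gn n (f x).
  have E (c : continuousType (cube R n.+1) X) :
    ctscomp (ctscomp g f) c = ctscomp g (ctscomp f c) by apply/continuousEP.
  split.
    move=> a b ax bx fab; apply: hni => //; rewrite !E.
    exact: homotopic_post.
  move=> c cx; have [|a ax gfac] := hns (ctscomp g c).
    by move=> v bv /=; rewrite cx.
  exists a => //; move: gfac; rewrite E; apply: gni => //.
  by move=> v bv /=; rewrite ax.
Qed.

End two_out_of_three.

Lemma weak_homotopy_equivalence_id (R : realType) (X : topologicalType) :
  weak_homotopy_equivalence R (ctsid X).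
Proof.
split=> //.
- move=> x; exists x; have c : continuous (fun _ : unit_interval R => x) by cts.
  by exists (cts_of c).
- move=> n x.
  have E (c : continuousType (cube R n.+1) X) :
    ctscomp (ctsid X) c = c by apply/continuousEP.
  split=> [a b _ _|c cx]; first by rewrite !E.
  by exists c => //; rewrite E; exact: homotopic_refl.
Qed.

(** * Homotopy extension for cubes *)

(** The Hausdorff property says that [cluster (nbhs p) q] forces [p = q]; pushing this relation
    forward along maps that jointly separate points reduces it to their targets. *)
Lemma cluster_continuous (X Y : topologicalType) (f : X -> Y) (p q : X) :
  continuous f -> cluster (nbhs p) q -> cluster (nbhs (f p)) (f q).
Proof.
move=> cf pq A B nA nB.
have [||u [Au Bu]] := pq (f @^-1` A) (f @^-1` B); [exact: cf|exact: cf|].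
by exists (f u).
Qed.

Lemma prod_compact_hausdorff (X Y : topologicalType) :
  compact_hausdorff X -> compact_hausdorff Y -> compact_hausdorff (X * Y)%type.
Proof.
move=> [cX hX] [cY hY]; split; first by rewrite -setXTT; exact: compact_setX.
move=> [a b] [a' b'] ab.
have /hX /= -> := cluster_continuous (@fst_continuous X Y) ab.
by have /hY /= -> := cluster_continuous (@snd_continuous X Y) ab.
Qed.

Lemma bigmax_continuous (R : realType) (T : topologicalType) (J : Type)
    (s : seq J) (F : J -> T -> R) : (forall j, continuous (F j)) ->
  continuous (fun t => \big[Num.max/0]_(j <- s) F j t).
Proof.
move=> cF; elim: s => [|j s IH].
  by under eq_fun do rewrite big_nil; exact: cst_continuous_fun.
by under eq_fun do rewrite big_cons; apply: maxr_continuous.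
Qed.

Section cubes.
Variable R : realType.
Local Notation I := (unit_interval R).
Local Notation i0 := (itv0 R).
Local Notation i1 := (itv1 R).

Lemma itv01 : i0 <> i1.
Proof. by move=> /(congr1 (@ival R)); rewrite ival0 ival1 => h; lra. Qed.

Section one_cube.
Variable n : nat.
Local Notation cube := (cube R n).

Lemma cube_proj_continuous (i : 'I_n) : continuous (fun v : cube => v i).
Proof. exact: (@proj_continuous 'I_n (fun=> I) i). Qed.

Lemma cube_continuous (T : topologicalType) (f : T -> cube) :
  (forall i, continuous (fun t => f t i)) -> continuous f.
Proof.
move=> cf t; apply/cvg_sup => i; move: t.
apply/(@continuousP _ (initial_topology (fun v : cube => v i))) => _ [B oB <-].
by move/continuousP: (cf i); apply.
Qed.

Lemma cube_compact_hausdorff : compact_hausdorff cube.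
Proof.
split.
  have -> : [set: cube] = [set f : cube | forall i, [set: I] (f i)].
    by apply/seteqP; split.
  exact: (@tychonoff 'I_n (fun=> I) (fun=> setT) (fun=> @interval_compact R)).
apply: (@hausdorff_product 'I_n (fun=> I)) => i; exact: interval_hausdorff.
Qed.

(** The sup norm after rescaling the cube to side 2 about its centre, so that the boundary is the
    unit sphere. In dimension 0 it is 0, in accordance with an empty boundary. *)
Definition cube_norm (v : cube) : R :=
  \big[Num.max/0]_(i < n) `|2 * ival (v i) - 1|.

Lemma cube_norm_continuous : continuous cube_norm.
Proof.
apply: bigmax_continuous => i; cts; exact: cube_proj_continuous.
Qed.

Lemma cube_norm_ge (v : cube) i : `|2 * ival (v i) - 1| <= cube_norm v.
Proof. exact: le_bigmax. Qed.

Lemma cube_norm_ge0 (v : cube) : 0 <= cube_norm v.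
Proof. exact: bigmax_ge_id. Qed.

Lemma cube_norm_le1 (v : cube) : cube_norm v <= 1.
Proof.
apply: bigmax_le => // i _; have := ival_ge0 (v i); have := ival_le1 (v i).
by move=> *; rewrite ler_norml; lra.
Qed.

Lemma cube_norm_max (v : cube) :
  cube_norm v = 0 \/ exists i, cube_norm v = `|2 * ival (v i) - 1|.
Proof.
rewrite /cube_norm.
apply: (big_ind (fun x : R => x = 0 \/ exists i, x = `|2 * ival (v i) - 1|)).
- by left.
- by move=> x y hx hy; rewrite maxEle; case: ifP.
- by move=> i _; right; exists i.
Qed.

Lemma cube_boundaryE (v : cube) : cube_boundary v <-> cube_norm v = 1.
Proof.
split=> [[i vi]|].
  apply/eqP; rewrite eq_le cube_norm_le1 /=.
  suff <- : `|2 * ival (v i) - 1| = 1 :> R by exact: cube_norm_ge.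
  case: vi => ->; rewrite ?ival0 ?ival1; first by rewrite mulr0 sub0r normrN1.
  by rewrite mulr1 (_ : 2 - 1 = 1) ?normr1 //; lra.
have [->|[i ->]] := cube_norm_max v; first by move/eqP; rewrite eq_sym oner_eq0.
move=> h; exists i.
have [h0|h0] := lerP 0 (2 * ival (v i) - 1);
  rewrite ?(ger0_norm h0) ?(ltr0_norm h0) in h.
  by right; apply: (@ival_inj R); rewrite ival1; lra.
by left; apply: (@ival_inj R); rewrite ival0; lra.
Qed.

Lemma cube_boundary_closed : closed (@cube_boundary R n).
Proof.
have -> : @cube_boundary R n = [set v | 1 <= cube_norm v].
  apply/seteqP; split=> v; first by move/cube_boundaryE => /= ->.
  by move=> v1; apply/cube_boundaryE/eqP; rewrite eq_le cube_norm_le1.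
apply: real_closed_le; cts.
exact: cube_norm_continuous.
Qed.

End one_cube.

Definition box_retraction (D : topologicalType) (dD : set D)
    (r : D * I -> D * I) :=
  [/\ continuous r, forall x, r (x, i0) = (x, i0),
      forall x t, dD x -> r (x, t) = (x, t) &
      forall z, (r z).2 = i0 \/ dD (r z).1].

Section cube_retraction.
Variable n : nat.
Local Notation cube := (cube R n).

(** The norm of the base coordinate after stretching by [1 + t]. Points of reach at most 1 are sent
    to the bottom, the others to the sides at height reach minus 1. *)
Definition cube_reach (z : cube * I) : R := (1 + ival z.2) * cube_norm z.1.

Lemma cube_reach_continuous : continuous cube_reach.
Proof. by rewrite /cube_reach; cts; exact: cube_norm_continuous. Qed.

(** Radial projection of [cube * I] onto the union of the bottom and the sides
    from the centre of the cube at height 2. *)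
Definition cube_retract (z : cube * I) : cube * I :=
  ((fun i => iclamp (2^-1 + 2^-1 *
      ((1 + ival z.2) * (2 * ival (z.1 i) - 1)) * (Num.max 1 (cube_reach z))^-1)),
   iclamp (cube_reach z - 1)).

Lemma cube_retraction : exists r, box_retraction (@cube_boundary R n) r.
Proof.
exists cube_retract; split.
- have ca := cube_reach_continuous.
  rewrite /cube_retract; apply: pair_continuous; last by cts.
  apply: cube_continuous => i.
  apply: (comp_continuous (g := @iclamp R)); last exact: iclamp_continuous.
  apply: addr_continuous; first by cts.
  apply: mulr_continuous.
    cts.
    by apply: (comp_continuous (g := fun v : cube => v i)); cts;
      exact: cube_proj_continuous.
  apply: invr_continuous; first by cts.
  by move=> z; rewrite gt_eqF // lt_max ltr01.
- move=> v; rewrite /cube_retract /cube_reach /= ival0 addr0 mul1r.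
  have v1 := cube_norm_le1 v.
  rewrite max_l // invr1 iclamp_le0 ?subr_le0 //; congr (_, _).
  apply/funext => i; rewrite -[RHS]ivalK; congr iclamp; rewrite mulr1 mul1r; lra.
(* On the boundary the reach is [1 + t], so the division exactly undoes the stretching. *)
- move=> v t /cube_boundaryE v1; rewrite /cube_retract /cube_reach /= v1 mulr1.
  have t0 := ival_ge0 t.
  rewrite max_r; last by lra.
  congr (_, _); last by rewrite -[RHS]ivalK; congr iclamp; lra.
  apply/funext => i; rewrite -[RHS]ivalK; congr iclamp; field.
  by rewrite gt_eqF //; lra.
- move=> [v t]; rewrite /cube_retract /cube_reach /=.
  set a := _ * cube_norm v; have [a1|a1] := leP a 1.
    by left; rewrite iclamp_le0 // subr_le0.
  right; have t0 := ival_ge0 t.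
  have m0 : 0 < cube_norm v.
    rewrite lt_neqAle cube_norm_ge0 andbT; apply/eqP => m0.
    by move: a1; rewrite /a -m0 mulr0; lra.
  (* A coordinate [i] attaining the norm lands on an endpoint: its stretched value is divided by its
     own absolute value, which gives 1 or -1. *)
  have [m|[i mi]] := cube_norm_max v; first by rewrite m ltxx in m0.
  exists i => /=.
  have a0 : a != 0 by rewrite gt_eqF // (lt_trans _ a1).
  have [h|h] := lerP 0 (2 * ival (v i) - 1);
    rewrite ?(ger0_norm h) ?(ltr0_norm h) in mi.
    right; apply: iclamp_ge1; rewrite -mi -/a -mulrA mulfV //; lra.
  left; apply: iclamp_le0.
  have -> : (2 * ival (v i) - 1) = - cube_norm v by rewrite mi opprK.
  by rewrite mulrN -/a mulrN mulNr -mulrA mulfV //; lra.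
Qed.

End cube_retraction.

Section prism_retraction.
Variable n : nat.

(** The interval factor becomes coordinate 0. This homeomorphism transports the box retraction of
    the larger cube to the prism. *)
Definition prism_to_cube (z : cube R n * I) : cube R n.+1 :=
  fun i => if unlift ord0 i is Some j then z.1 j else z.2.

Definition cube_to_prism (v : cube R n.+1) : cube R n * I :=
  ((fun j => v (lift ord0 j)) , v ord0).

Lemma prism_to_cubeK : cancel prism_to_cube cube_to_prism.
Proof.
move=> [c t]; rewrite /cube_to_prism /prism_to_cube /= unlift_none.
by congr (_, _); apply/funext => j; rewrite liftK.
Qed.

Lemma cube_to_prismK : cancel cube_to_prism prism_to_cube.
Proof.
by move=> v; apply/funext => i; rewrite /prism_to_cube; case: unliftP => [j|] ->.
Qed.

Lemma prism_to_cube_continuous : continuous prism_to_cube.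
Proof.
apply: cube_continuous => i; rewrite /prism_to_cube.
case: (unlift ord0 i) => [j|]; last exact: snd_continuous.
apply: (comp_continuous (g := fun v : cube R n => v j)).
  exact: fst_continuous.
exact: cube_proj_continuous.
Qed.

Lemma cube_to_prism_continuous : continuous cube_to_prism.
Proof.
apply: pair_continuous; last exact: cube_proj_continuous.
by apply: cube_continuous => j; exact: cube_proj_continuous.
Qed.

Definition prism_boundary : set (cube R n * I) :=
  [set z | [\/ cube_boundary z.1, z.2 = i0 | z.2 = i1]].

Lemma prism_boundaryP (z : cube R n * I) :
  cube_boundary (prism_to_cube z) <-> prism_boundary z.
Proof.
case: z => c t; split=> [[i]|[[j cj]|/= ->|/= ->]].
- rewrite /prism_to_cube; case: unliftP => [j _|_] /=.
    by move=> cj; apply: Or31; exists j.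
  by case; [exact: Or32|exact: Or33].
- by exists (lift ord0 j); rewrite /prism_to_cube liftK.
- by exists ord0; left; rewrite /prism_to_cube unlift_none.
- by exists ord0; right; rewrite /prism_to_cube unlift_none.
Qed.

Lemma prism_retraction : exists r, box_retraction prism_boundary r.
Proof.
have [rc [cr r0 rb rJ]] := cube_retraction n.+1.
pose r (z : (cube R n * I) * I) :=
  let y := rc (prism_to_cube z.1, z.2) in (cube_to_prism y.1, y.2).
exists r; split.
- have cy : continuous
    (fun z : cube R n * I * I => rc (prism_to_cube z.1, z.2)).
    apply: (comp_continuous (g := rc)) => //.
    apply: pair_continuous; last exact: snd_continuous.
    apply: (comp_continuous (g := prism_to_cube)); first exact: fst_continuous.
    exact: prism_to_cube_continuous.
  apply: pair_continuous; last exact: (comp_continuous cy (@snd_continuous _ _)).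
  apply: (comp_continuous (g := cube_to_prism)).
    exact: (comp_continuous cy (@fst_continuous _ _)).
  exact: cube_to_prism_continuous.
- by move=> z; rewrite /r /= r0 /= prism_to_cubeK.
- by move=> z t /prism_boundaryP zb; rewrite /r /= rb //= prism_to_cubeK.
- move=> z; rewrite /r /=.
  have [->|] := rJ (prism_to_cube z.1, z.2); first by left.
  by rewrite -[X in cube_boundary X]cube_to_prismK => /prism_boundaryP; right.
Qed.

End prism_retraction.

Lemma itv_closed1 (t : I) : closed [set t].
Proof.
by apply: accessible_closed_set1; apply: hausdorff_accessible;
  exact: interval_hausdorff.
Qed.

(** Compose the data on bottom and sides with the retraction. The side data [l] depends on time
    only, as all boundary points follow one track of the base point. *)
Lemma cube_hep (n : nat) (W : topologicalType) (f : cube R n -> W)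
    (l : I -> W) : continuous f -> continuous l ->
  (forall c, cube_boundary c -> f c = l i0) ->
  exists F : cube R n * I -> W, [/\ continuous F, forall c, F (c, i0) = f c &
    forall c t, cube_boundary c -> F (c, t) = l t].
Proof.
move=> cf cl fl; have [r [cr r0 rb rJ]] := cube_retraction n.
pose F z := if (r z).2 == i0 then f (r z).1 else l (r z).2.
exists F; split.
- apply: (@pasting_continuous _ _ 2
    (fun i => if i == ord0 then r @^-1` (snd @^-1` [set i0])
              else r @^-1` (fst @^-1` @cube_boundary R n))
    (fun i z => if i == ord0 then f (r z).1 else l (r z).2)).
  + move=> i; case: (i == ord0); apply: continuous_preimage_closed => //.
      apply: continuous_preimage_closed; first exact: snd_continuous.
      exact: itv_closed1.
    apply: continuous_preimage_closed; first exact: fst_continuous.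
    exact: cube_boundary_closed.
  + by move=> i; case: (i == ord0) => /=; cts.
  + by move=> z; have [z0|zb] := rJ z; [exists ord0|exists ord_max].
  + move=> i z; rewrite /F; case: (i == ord0) => /= zi; first by rewrite zi eqxx.
    by case: eqP => // ->; exact: fl.
- by move=> c; rewrite /F r0 /= eqxx.
- by move=> c t cb; rewrite /F rb //=; case: eqP => // ->; exact: fl.
Qed.

(** The homotopy is prescribed on the whole boundary of [cube * I]; over the
    boundary of the cube it only depends on the last two coordinates. *)
Lemma prism_hep (n : nat) (W : topologicalType) (f e0 e1 : cube R n * I -> W)
    (l : I * I -> W) :
  continuous f -> continuous e0 -> continuous e1 -> continuous l ->
  (forall c, f (c, i0) = e0 (c, i0)) -> (forall c, f (c, i1) = e1 (c, i0)) ->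
  (forall c t, cube_boundary c -> f (c, t) = l (t, i0)) ->
  (forall c s, cube_boundary c -> e0 (c, s) = l (i0, s)) ->
  (forall c s, cube_boundary c -> e1 (c, s) = l (i1, s)) ->
  exists F : cube R n * I * I -> W, [/\ continuous F,
    forall c t, F (c, t, i0) = f (c, t), forall c s, F (c, i0, s) = e0 (c, s),
    forall c s, F (c, i1, s) = e1 (c, s) &
    forall c t s, cube_boundary c -> F (c, t, s) = l (t, s)].
Proof.
move=> cf ce0 ce1 cl fe0 fe1 fl e0l e1l.
have [r [cr r0 rb rJ]] := prism_retraction n.
(* The order of the tests is immaterial: the compatibility hypotheses make the pieces agree where
   they meet, as the next four facts record. *)
pose G (y : cube R n * I * I) :=
  if y.2 == i0 then f y.1 else if y.1.2 == i0 then e0 (y.1.1, y.2)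
  else if y.1.2 == i1 then e1 (y.1.1, y.2) else l (y.1.2, y.2).
have Gf y : y.2 = i0 -> G y = f y.1 by move=> y0; rewrite /G y0 eqxx.
have Ge0 y : y.1.2 = i0 -> G y = e0 (y.1.1, y.2).
  case: y => [[c t] s] /= ->; rewrite /G /= eqxx.
  by case: eqP => // ->; rewrite fe0.
have Ge1 y : y.1.2 = i1 -> G y = e1 (y.1.1, y.2).
  case: y => [[c t] s] /= ->; rewrite /G /=; case: eqP => [->|_].
    by rewrite fe1.
  by case: eqP => [/esym/itv01//|_]; rewrite eqxx.
have Gl y : cube_boundary y.1.1 -> G y = l (y.1.2, y.2).
  case: y => [[c t] s] /= cb; rewrite /G /=; case: eqP => [->|_].
    by rewrite fl.
  by case: eqP => [->|_]; [rewrite e0l|case: eqP => // ->; rewrite e1l].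
exists (G \o r); split.
- apply: (@pasting_continuous _ _ 4
    (fun i => match val i with
      | 0%N => r @^-1` (snd @^-1` [set i0])
      | 1%N => r @^-1` ((fun y => y.1.2) @^-1` [set i0])
      | 2%N => r @^-1` ((fun y => y.1.2) @^-1` [set i1])
      | _ => r @^-1` ((fun y => y.1.1) @^-1` @cube_boundary R n) end)
    (fun i z => match val i with
      | 0%N => f (r z).1
      | 1%N => e0 ((r z).1.1, (r z).2)
      | 2%N => e1 ((r z).1.1, (r z).2)
      | _ => l ((r z).1.2, (r z).2) end)).
  + have c11 : continuous (fun y : cube R n * I * I => y.1.1) by cts.
    have c12 : continuous (fun y : cube R n * I * I => y.1.2) by cts.
    case=> -[|[|[|i]]] Hi /=;
      (apply: continuous_preimage_closed; first exact: cr);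
      apply: continuous_preimage_closed; try by [].
    * exact: snd_continuous.
    * exact: itv_closed1.
    * exact: itv_closed1.
    * exact: itv_closed1.
    * exact: cube_boundary_closed.
  + by case=> -[|[|[|i]]] Hi /=; cts.
  + move=> z; have [z0|[zb|zb|zb]] := rJ z.
    * by exists (inord 0); rewrite /= inordK.
    * by exists (inord 3); rewrite /= inordK.
    * by exists (inord 1); rewrite /= inordK.
    * by exists (inord 2); rewrite /= inordK.
  + by case=> -[|[|[|i]]] Hi z /= zi; [exact: Gf|exact: Ge0|exact: Ge1|exact: Gl].
- by move=> c t; rewrite /= r0 Gf.
- by move=> c s; rewrite /= rb ?Ge0 //; exact: Or32.
- by move=> c s; rewrite /= rb ?Ge1 //; exact: Or33.
- by move=> c t s cb; rewrite /= rb ?Gl //; exact: Or31.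
Qed.

End cubes.

(** * k-spaces and weak Hausdorff spaces *)

Lemma compact_set_type (X : topologicalType) (C : set X) :
  compact C -> compact [set: set_type C].
Proof.
move=> cC F PF _.
have [|p [Cp clp]] := cC (set_val @ F) _.
  by apply: (@filterS _ F _ setT) => [x _|]; [exact: (set_valP x)|exact: filterT].
exists (exist _ p (mem_set Cp)); split=> // A B FA [_ [[V oV <-] Vp VB]].
have [||q [[x Ax <-] Vx]] := clp (set_val @` A) V.
- by apply: (@filterS _ F _ A) => [x Ax|//]; exists x.
- by apply: open_nbhs_nbhs; split.
by exists x; split=> //; exact: VB.
Qed.

Lemma set_type_compact_hausdorff (X : topologicalType) (C : set X) :
  compact_hausdorff X -> closed C -> compact_hausdorff (set_type C).
Proof.
move=> [cX hX] cC; split.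
  by apply: compact_set_type; apply: subclosed_compact cX _.
move=> p q pq; apply: val_inj; apply: hX.
exact: (cluster_continuous (@set_val_continuous X C)).
Qed.

Section weak_hausdorff.
Variable Z : cgType.

(** A closed subspace of [K] is again compact Hausdorff, so its image is the range of a test map. *)
Lemma weak_hausdorff_closed_image (K : topologicalType)
    (u : continuousType K Z) (C : set K) :
  compact_hausdorff K -> closed C -> closed (u @` C).
Proof.
move=> cK cC; have cu : continuous (fun x : set_type C => u (set_val x)).
  by apply: comp_continuous; [exact: set_val_continuous|exact: cts_fun].
have := weak_hausdorffP _ (set_type_compact_hausdorff cK cC) (cts_of cu).
congr closed; apply/seteqP; split=> z /=.
  by move=> [x _ <-]; exists (set_val x) => //; exact: set_valP.
by move=> [x Cx <-]; exists (exist _ x (mem_set Cx)).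
Qed.

Lemma weak_hausdorff_closed1 (K : topologicalType) (z : Z) (k : K) :
  compact_hausdorff K -> closed [set z].
Proof.
(* The point is the range of a constant map; [k] guarantees that this range is not empty. *)
move=> cK; have := weak_hausdorffP _ cK (cts_of (@cst_continuous_fun K Z z)).
congr closed; apply/seteqP; split=> y /=; first by move=> [].
by move=> ->; exists k.
Qed.

(** Images of compact Hausdorff spaces in [Z] are Hausdorff: disjoint fibres are separated by
    normality, and the separation descends because images of closed sets are closed. *)
Lemma weak_hausdorff_equalizer (M : topologicalType)
    (a b : continuousType M Z) :
  compact_hausdorff M -> closed [set m | a m = b m].
Proof.
move=> cM.
(* Two copies of [M] form one compact Hausdorff space carrying both [a] and [b]. *)
pose h (w : bool * M) := if w.1 then a w.2 else b w.2.
have ch : continuous h.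
  apply: (@pasting_continuous _ _ 2
    (fun i => fst @^-1` [set i == ord0])
    (fun i w => if i == ord0 then a w.2 else b w.2)).
  - move=> i; apply: continuous_preimage_closed; first exact: fst_continuous.
    exact: discrete_closed.
  - by move=> i; case: (i == ord0); cts.
  - by case=> [[] m]; [exists ord0|exists ord_max].
  - by move=> i w /= <-.
have cW : compact_hausdorff (bool * M)%type.
  apply: prod_compact_hausdorff => //.
  by split; [exact: bool_compact|exact: discrete_hausdorff].
rewrite -openC openE => m0 /= ab0.
have cF (z : Z) : closed (h @^-1` [set z]).
  apply: continuous_preimage_closed => //.
  exact: (weak_hausdorff_closed1 m0 cM).
have [C nC CF] : filter_from (set_nbhs (h @^-1` [set a m0])) closure
    (~` (h @^-1` [set b m0])).
  apply: (compact_normal cW.2 cW.1) => //; apply/set_nbhsP.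
  exists (~` (h @^-1` [set b m0])); split=> //; first exact: closed_openC.
  by move=> w /= ->.
have /set_nbhsP[U1 [oU1 FU1 U1C]] := nC.
(* Every [w] over [V1] lies in [U1], hence in [C], whereas none over [V2] does; so [V1] and [V2]
   share no point of the range of [h]. *)
pose V1 := ~` (h @` (~` U1)); pose V2 := ~` (h @` closure C).
have oV1 : open V1.
  apply: closed_openC; apply: (@weak_hausdorff_closed_image _ (cts_of ch)) => //.
  exact: open_closedC.
have oV2 : open V2.
  apply: closed_openC; apply: (@weak_hausdorff_closed_image _ (cts_of ch)) => //.
  exact: closed_closure.
rewrite /interior nbhsE; exists (a @^-1` V1 `&` b @^-1` V2).
  split.
    by apply: openI; apply: continuous_preimage_open => //; exact: cts_fun.
  split=> /=.
    by move=> [w nU1 hw]; apply: nU1; exact: FU1.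
  by move=> [w Cw hw]; exact: (CF w).
move=> m [/= V1m V2m] abm; apply: V1m; exists (true, m) => //= U1m.
by apply: V2m; exists (true, m) => //; apply: subset_closure; exact: U1C.
Qed.

End weak_hausdorff.

Definition k_space (T : topologicalType) := forall U : set T, k_open U -> open U.

Lemma compact_hausdorff_k_space (K : topologicalType) :
  compact_hausdorff K -> k_space K.
Proof. by move=> cK U /(_ K cK (ctsid K)). Qed.

Lemma cg_k_space (T : cgType) : k_space T.
Proof. exact: k_spaceP. Qed.

Lemma k_space_continuous (S T : topologicalType) (f : S -> T) : k_space S ->
  (forall K : topologicalType, compact_hausdorff K ->
     forall u : continuousType K S, continuous (fun k => f (u k))) ->
  continuous f.
Proof.
move=> kS cf; apply/continuousP => U oU; apply: kS => K cK u.
exact: (continuous_preimage_open (cf K cK u)).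
Qed.

Section kification_theory.
Variable T : topologicalType.

Lemma kification_openE (U : set T) :
  open (U : set (kification T)) = @k_open T U.
Proof. by []. Qed.

Lemma kification_val_continuous : continuous (id : kification T -> T).
Proof.
apply/continuousP => U oU; rewrite kification_openE => K cK u.
by apply: continuous_preimage_open => //; exact: cts_fun.
Qed.

Lemma kification_continuous (S : topologicalType) (f : S -> T) : k_space S ->
  continuous f -> continuous (f : S -> kification T).
Proof.
move=> kS cf; apply: k_space_continuous => // K cK u; apply/continuousP => U oU.
have cfu : continuous (fun k => f (u k)) by cts.
exact: (oU K cK (cts_of cfu)).
Qed.

(** Compact Hausdorff spaces have the same maps to [T] as to its k-ification, so the test for
    openness is unchanged. *)
Lemma kification_k_space : k_space (kification T).
Proof.
move=> U kU; rewrite kification_openE => K cK u.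
have cu : continuous (u : K -> kification T).
  apply: kification_continuous; last exact: cts_fun.
  exact: compact_hausdorff_k_space.
exact: (kU K cK (cts_of cu)).
Qed.

End kification_theory.

(** A test map into [T] is restricted to the preimage of [C]: closedness keeps that preimage
    compact, and openness lets open subsets of it stay open in the whole domain. *)
Lemma clopen_k_space (T : topologicalType) (C : set T) : k_space T ->
  open C -> closed C -> k_space (set_type C).
Proof.
move=> kT oC cC W kW; exists (set_val @` W); last first.
  apply/seteqP; split=> x /=; last by move=> Wx; exists x.
  by move=> [y Wy /val_inj <-].
apply: kT => K cK u.
have cD : closed (u @^-1` C).
  by apply: continuous_preimage_closed => //; exact: cts_fun.
have uC (x : set_type (u @^-1` C)) : u (set_val x) \in C.
  exact/mem_set/(set_valP x).
pose u' (x : set_type (u @^-1` C)) : set_type C :=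
  exist _ (u (set_val x)) (uC x).
have cu' : continuous u'.
  apply: set_type_continuous.
  exact: (comp_continuous (@set_val_continuous K _) (@cts_fun _ _ u)).
have [V oV VE] := kW _ (set_type_compact_hausdorff cK cD) (cts_of cu').
have -> : u @^-1` (set_val @` W) = V `&` u @^-1` C.
  apply/seteqP; split=> k /=.
    move=> [y Wy yk]; have Ck : C (u k) by rewrite -yk; exact: set_valP.
    split=> //; pose x : set_type (u @^-1` C) := exist _ k (mem_set Ck).
    suff : (set_val @^-1` V) x by [].
    rewrite VE /= cts_ofE; suff -> : u' x = y by [].
    by apply: val_inj; exact: esym yk.
  move=> [Vk Ck]; pose x : set_type (u @^-1` C) := exist _ k (mem_set Ck).
  have : (set_val @^-1` V) x by [].
  by rewrite VE /= => Wx; exists (u' x).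
by apply: openI => //; apply: continuous_preimage_open => //; exact: cts_fun.
Qed.

(** Along a test map [v], the preimage of the range of [u] is the projection of the pairs with
    [u = v]. These form an intersection of equalizers in the weak Hausdorff [Z j], hence a compact
    set. *)
Lemma weak_hausdorff_separated (M : topologicalType) (J : Type)
    (Z : J -> cgType) (e : forall j, continuousType M (Z j)) : k_space M ->
  (forall x y, (forall j, e j x = e j y) -> x = y) ->
  forall K : topologicalType, compact_hausdorff K ->
  forall u : continuousType K M, closed (range u).
Proof.
move=> kM e_inj K cK u; rewrite -openC; apply: kM => L cL v.
rewrite preimage_setC; apply: closed_openC.
have cKL := prod_compact_hausdorff cK cL.
rewrite [X in closed X](_ : _ =
    snd @` (\bigcap_j [set w : K * L | e j (u w.1) = e j (v w.2)])); last first.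
  apply/seteqP; split=> l /=.
    by move=> [k _ ukl]; exists (k, l) => // j _ /=; rewrite ukl.
  by move=> [[k l'] /= uv <-]; exists k => //; apply: e_inj => j; exact: uv.
apply: compact_closed; first exact: cL.2.
apply: continuous_compact.
  by apply: continuous_subspaceT => w; exact: snd_continuous.
apply: subclosed_compact cKL.1 _ => //; apply: closed_bigI => j _.
have ca : continuous (fun w : K * L => e j (u w.1)) by cts.
have cb : continuous (fun w : K * L => e j (v w.2)) by cts.
exact: (@weak_hausdorff_equalizer _ _ (cts_of ca) (cts_of cb) cKL).
Qed.

(** * Mapping path spaces *)

Section mapping_path_space.
Variables (R : realType) (V W : cgType) (g : continuousType V W).
Local Notation I := (unit_interval R).
Local Notation i0 := (itv0 R).
Local Notation i1 := (itv1 R).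

Record mapping_path := MappingPath {
  mp_base : V;
  mp_path : continuousType I W;
  mp_start : mp_path i0 = g mp_base
}.

HB.instance Definition _ := gen_eqMixin mapping_path.
HB.instance Definition _ := gen_choiceMixin mapping_path.

Lemma mapping_path_eq (x y : mapping_path) :
  mp_base x = mp_base y -> mp_path x =1 mp_path y -> x = y.
Proof.
case: x y => [v c e] [v' c' e'] /= vv' /continuousEP cc'; subst v' c'.
by congr MappingPath; exact: Prop_irrelevance.
Qed.

Section mapping_path_of.
Variables (K : topologicalType) (a : K -> V) (h : K * I -> W).
Hypothesis ch : continuous h.
Hypothesis e : forall k, h (k, i0) = g (a k).

Lemma slice_continuous (k : K) : continuous (fun t => h (k, t)).
Proof. by cts. Qed.

Definition mapping_path_of (k : K) : mapping_path :=
  @MappingPath (a k) (cts_of (@slice_continuous k)) (e k).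

End mapping_path_of.

(** The final topology for the families of paths parametrised by compact
    Hausdorff spaces: the k-ification of the compact-open topology. *)
Definition mapping_path_open (U : set mapping_path) :=
  forall K : topologicalType, compact_hausdorff K ->
    forall (a : K -> V) (h : K * I -> W) (ca : continuous a)
      (ch : continuous h) (e : forall k, h (k, i0) = g (a k)),
    open (mapping_path_of ch e @^-1` U).

Lemma mapping_path_openT : mapping_path_open [set: mapping_path].
Proof. by move=> K _ a h _ ch e; rewrite preimage_setT; exact: openT. Qed.

Lemma mapping_path_openI : setI_closed mapping_path_open.
Proof.
move=> A B oA oB K cK a h ca ch e; rewrite preimage_setI.
by apply: openI; [exact: oA|exact: oB].
Qed.

Lemma mapping_path_open_bigU (J : Type) (f : J -> set mapping_path) :
  (forall j, mapping_path_open (f j)) -> mapping_path_open (\bigcup_j f j).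
Proof.
move=> of_ K cK a h ca ch e; rewrite preimage_bigcup.
by apply: bigcup_open => j _; exact: of_.
Qed.

HB.instance Definition _ := isOpenTopological.Build mapping_path
  mapping_path_openT mapping_path_openI mapping_path_open_bigU.

Lemma mapping_path_openE (U : set mapping_path) : open U = mapping_path_open U.
Proof. by []. Qed.

(** The topology makes families over compact Hausdorff spaces continuous; a k-space of parameters is
    tested by exactly these. *)
Lemma mapping_path_of_continuous (T : topologicalType) (a : T -> V)
    (h : T * I -> W) (ca : continuous a) (ch : continuous h)
    (e : forall t, h (t, i0) = g (a t)) :
  k_space T -> continuous (mapping_path_of ch e).
Proof.
move=> kT; apply: k_space_continuous => // K cK u.
have ca' : continuous (fun k => a (u k)) by cts.
have ch' : continuous (fun w : K * I => h (u w.1, w.2)) by cts.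
have e' k : (fun w : K * I => h (u w.1, w.2)) (k, i0) = g (a (u k)) by exact: e.
have -> : (fun k => mapping_path_of ch e (u k)) = mapping_path_of ch' e'.
  by apply/funext => k; apply: mapping_path_eq.
by apply/continuousP => U oU; exact: (oU K cK).
Qed.

Lemma mapping_path_k_space : k_space mapping_path.
Proof.
move=> U kU; rewrite mapping_path_openE => K cK a h ca ch e.
have c := @mapping_path_of_continuous _ _ _ ca ch e
  (compact_hausdorff_k_space cK).
exact: (kU K cK (cts_of c)).
Qed.

Lemma mp_base_continuous : continuous mp_base.
Proof.
apply/continuousP => U oU; rewrite mapping_path_openE => K cK a h ca ch e.
exact: (continuous_preimage_open ca oU).
Qed.

(** The interval is compact and regular: [t] has a neighbourhood [B] whose closure the path sends
    into [U], and sending that compact closure into [U] is an open condition on paths. *)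
Lemma mp_eval_continuous :
  continuous (fun z : mapping_path * I => mp_path z.1 z.2).
Proof.
move=> [x t] A; rewrite /= nbhsE => -[U [oU Uxt] UA].
have nO : nbhs t (mp_path x @^-1` U).
  by apply: open_nbhs_nbhs; split=> //; apply: continuous_preimage_open => //;
    exact: cts_fun.
have [B nB BU] : filter_from (nbhs t) closure (mp_path x @^-1` U).
  apply: (@compact_regular I t setT) => //; [exact: interval_hausdorff| |].
    exact: interval_compact.
  exact: filterT.
have cB : compact (closure B).
  by apply: subclosed_compact (@interval_compact R) _ => //; exact: closed_closure.
pose S : set mapping_path := [set y | closure B `<=` mp_path y @^-1` U].
have oS : open S.
  rewrite mapping_path_openE => K cK a h ca ch e; rewrite openE => k /= Sk.
  (* The tube lemma, in the form of near coverings of the compact set [closure B]. *)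
  have /compact_near_coveringP := cB.
  apply => s Bs; have Us : U (h (k, s)) by exact: Sk.
  have [[M N] /= [nM nN] MN] : nbhs (k, s) (h @^-1` U).
    by apply: (ch (k, s)); apply: open_nbhs_nbhs.
  by exists (N, M) => //= -[s' k'] [/= Ns' Mk']; exact: (MN (k', s')).
exists (S, B) => /=; first by split=> //; apply: open_nbhs_nbhs; split.
by move=> [y s] [/= Sy Bs]; apply: UA; apply: Sy; exact: subset_closure.
Qed.

Lemma mapping_path_weak_hausdorff (K : topologicalType) :
  compact_hausdorff K -> forall u : continuousType K mapping_path,
  closed (range u).
Proof.
have ct (t : I) : continuous (fun x : mapping_path => mp_path x t).
  apply: (comp_continuous (f := fun x => (x, t)) _ mp_eval_continuous).
  by cts.
(* [None] indexes the base and [Some t] the evaluation at [t]; together these separate mapping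
   paths. *)
pose Z (j : option I) : cgType := if j is Some _ then W else V.
pose e (j : option I) : continuousType mapping_path (Z j) :=
  if j is Some t then cts_of (ct t) else cts_of mp_base_continuous.
apply: (@weak_hausdorff_separated _ _ Z e _ _ K) => [|x y xy].
  exact: mapping_path_k_space.
apply: mapping_path_eq; first exact: (xy None).
by move=> t; exact: (xy (Some t)).
Qed.

HB.instance Definition _ := isCompactlyGenerated.Build mapping_path
  mapping_path_k_space mapping_path_weak_hausdorff.

End mapping_path_space.

(** * Projection and end point of the mapping path space *)

Section mapping_path_factorisation.
Variables (R : realType) (V W : cgType) (g : continuousType V W).
Local Notation I := (unit_interval R).
Local Notation i0 := (itv0 R).
Local Notation i1 := (itv1 R).
Local Notation N := (mapping_path R g).

Lemma mp_at_continuous (t : I) : continuous (fun x : N => mp_path x t).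
Proof.
apply: (comp_continuous (f := fun x : N => (x, t)) _
  (@mp_eval_continuous R V W g)).
by cts.
Qed.

Lemma mp_along_continuous (T : topologicalType) (a : T -> N) (s : T -> I) :
  continuous a -> continuous s -> continuous (fun t => mp_path (a t) (s t)).
Proof.
move=> ca cs; apply: (comp_continuous (f := fun t => (a t, s t)) _
  (@mp_eval_continuous R V W g)).
exact: pair_continuous.
Qed.

Definition mp_proj : continuousType N V := cts_of (@mp_base_continuous R V W g).
Definition mp_end : continuousType N W := cts_of (@mp_at_continuous i1).

Lemma cube_k_space n : k_space (cube R n).
Proof. exact/compact_hausdorff_k_space/cube_compact_hausdorff. Qed.

Lemma prism_k_space n : k_space (cube R n * I)%type.
Proof.
apply: compact_hausdorff_k_space; apply: prod_compact_hausdorff.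
  exact: cube_compact_hausdorff.
exact: interval_CH.
Qed.

(** A homotopy [H] of base points lifts by filling a prism with bottom [g H], the paths of [a] and
    [b] at the two ends, and the path of [x] over the boundary. *)
Lemma mp_proj_pi_injective n (x : N) : pi_injective R mp_proj n x.
Proof.
move=> a b ax bx [H [H0 H1 HA]].
have cH : continuous H := @cts_fun _ _ H.
have [F [cF Ff Fe0 Fe1 Fl]] : exists F : cube R n * I * I -> W,
  [/\ continuous F,
    forall c t, F (c, t, i0) = g (H (c, t)),
    forall c s, F (c, i0, s) = mp_path (a c) s,
    forall c s, F (c, i1, s) = mp_path (b c) s &
    forall c t s, cube_boundary c -> F (c, t, s) = mp_path x s].
  apply: (@prism_hep R n W (fun z => g (H z)) (fun z => mp_path (a z.1) z.2)
    (fun z => mp_path (b z.1) z.2) (fun z => mp_path x z.2)).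
  - by cts.
  - by apply: mp_along_continuous; cts.
  - by apply: mp_along_continuous; cts.
  - by cts.
  - by move=> c; rewrite H0 mp_start.
  - by move=> c; rewrite H1 mp_start.
  - by move=> c t bc /=; rewrite HA // mp_start /= ax.
  - by move=> c s bc /=; rewrite ax.
  - by move=> c s bc /=; rewrite bx.
have e (z : cube R n * I) : F (z, i0) = g (H z) by case: z => v t; exact: Ff.
have cA := @mapping_path_of_continuous R V W g _ H F cH cF e (@prism_k_space n).
exists (cts_of cA); split=> [v|v|v t bv]; apply: mapping_path_eq => [|s] /=.
- exact: H0.
- exact: Fe0.
- exact: H1.
- exact: Fe1.
- by rewrite HA //= ax.
- by rewrite cts_ofE Fl // ax.
Qed.

(** The paths are obtained by extending [g c] along the path of [x]; the lift then projects to [c]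
    on the nose. *)
Lemma mp_proj_pi_surjective n (x : N) : pi_surjective R mp_proj n x.
Proof.
move=> c cx; have cc : continuous c := @cts_fun _ _ c.
have [|||F [cF Ff Fl]] := @cube_hep R n W (fun v => g (c v)) (mp_path x).
- by cts.
- exact: cts_fun.
- by move=> v bv; rewrite cx // mp_start.
have ca := @mapping_path_of_continuous R V W g _ c F cc cF Ff (@cube_k_space n).
exists (cts_of ca).
  by move=> v bv; apply: mapping_path_eq => [|t] /=; [exact: cx|exact: Fl].
suff -> : ctscomp mp_proj (cts_of ca) = c by exact: homotopic_refl.
exact/continuousEP.
Qed.

Lemma mp_proj_weq : weak_homotopy_equivalence R mp_proj.
Proof.
split.
- move=> x y [c [c0 c1]].
  (* Injectivity on components is the case of the 0-cube, a single point with empty boundary. *)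
  pose a (z : N) : continuousType (cube R 0) N :=
    cts_of (@cst_continuous_fun (cube R 0) N z).
  have nb (v : cube R 0) : ~ cube_boundary v by case=> -[].
  have cH : continuous (fun z : cube R 0 * I => c z.2) by cts.
  have [||| H [H0 H1 _]] := @mp_proj_pi_injective 0 x (a x) (a y).
  + by move=> v /nb.
  + by move=> v /nb.
  + by exists (cts_of cH); split=> [v|v|v t /nb//]; rewrite cts_ofE.
  pose v0 : cube R 0 := fun=> i0.
  have cp : continuous (fun t => H (v0, t)).
    apply: (comp_continuous (f := fun t => (v0, t)) _ (@cts_fun _ _ H)).
    by cts.
  by exists (cts_of cp); rewrite !cts_ofE H0 H1.
- move=> v.
  exists (@MappingPath R V W g v (cts_of (@cst_continuous_fun I W (g v))) erefl).
  by exists (cts_of (@cst_continuous_fun I V v)).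
- by move=> n x; split; [exact: mp_proj_pi_injective|exact: mp_proj_pi_surjective].
Qed.

Lemma mp_end_serre_fibration : serre_fibration R mp_end.
Proof.
move=> n a h ah.
(* The lift at time [s] follows the path of [a], then [h] up to time [s], at speed [1 + s]; the base
   does not move. *)
pose F (z : cube R n * I * I) := let u := ival z.2 * (1 + ival z.1.2) in
  if u <= 1 then mp_path (a z.1.1) (iclamp u) else h (z.1.1, iclamp (u - 1)).
have cF : continuous F.
  apply: (@pasting_continuous _ _ 2
    (fun i z => if i == ord0 then ival z.2 * (1 + ival z.1.2) <= 1
                else 1 <= ival z.2 * (1 + ival z.1.2))
    (fun i z => if i == ord0
       then mp_path (a z.1.1) (iclamp (ival z.2 * (1 + ival z.1.2)))
       else h (z.1.1, iclamp (ival z.2 * (1 + ival z.1.2) - 1)))).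
  - by move=> i; case: (i == ord0) => /=; apply: real_closed_le; cts.
  - move=> i; case: (i == ord0) => /=; last by cts.
    by apply: mp_along_continuous; cts.
  - move=> z; have [z1|/ltW z1] := leP (ival z.2 * (1 + ival z.1.2)) 1.
      by exists ord0.
    by exists ord_max.
  - move=> i z; rewrite /F; case: (i == ord0) => zi; first by rewrite zi.
    case: ifP => // zi'.
    have -> : ival z.2 * (1 + ival z.1.2) = 1 by apply/eqP; rewrite eq_le zi zi'.
    by rewrite subrr iclamp_ge1 // iclamp_le0 // -ah.
have ca : continuous (fun z : cube R n * I => mp_base (a z.1)).
  apply: (comp_continuous (f := fun z => a z.1) _ (@mp_base_continuous R V W g)).
  by cts.
have e (z : cube R n * I) : F (z, i0) = g (mp_base (a z.1)).
  by rewrite /F /= ival0 mul0r ler01 iclamp_le0 // mp_start.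
have cA := @mapping_path_of_continuous R V W g _ _ F ca cF e (@prism_k_space n).
exists (cts_of cA); split.
  move=> v; apply: mapping_path_eq => //= t.
  by rewrite !cts_ofE /F /= ival0 addr0 mulr1 ival_le1 ivalK.
move=> [v s]; rewrite (_ : mp_end _ = F (v, s, i1)) // /F /= ival1 mul1r.
case: ifP => s1; last by rewrite [1 + _]addrC addrK ivalK.
have s0 : s = i0.
  by apply: (@ival_inj R); rewrite ival0; have := ival_ge0 s; lra.
by rewrite s0 ival0 addr0 iclamp_ge1 // -ah.
Qed.

(** Sliding the end points back along the reversed paths turns the given homotopy into one between
    the images under [g] of the bases; [g] and then the projection reflect it. *)
Lemma mp_end_pi_injective n (x : N) :
  pi_injective R g n (mp_base x) -> pi_injective R mp_end n x.
Proof.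
move=> gi a b ax bx [H [H0 H1 HA]].
have [F [cF Ff Fe0 Fe1 Fl]] : exists F : cube R n * I * I -> W,
  [/\ continuous F,
    forall c t, F (c, t, i0) = H (c, t),
    forall c s, F (c, i0, s) = mp_path (a c) (irev s),
    forall c s, F (c, i1, s) = mp_path (b c) (irev s) &
    forall c t s, cube_boundary c -> F (c, t, s) = mp_path x (irev s)].
  have cr := @irev_continuous R.
  apply: (@prism_hep R n W H (fun z => mp_path (a z.1) (irev z.2))
    (fun z => mp_path (b z.1) (irev z.2)) (fun z => mp_path x (irev z.2))).
  - exact: cts_fun.
  - by apply: mp_along_continuous; cts.
  - by apply: mp_along_continuous; cts.
  - by cts.
  - by move=> c; rewrite H0 /= irev0.
  - by move=> c; rewrite H1 /= irev0.
  - by move=> c t bc /=; rewrite HA //= ax // irev0.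
  - by move=> c s bc /=; rewrite ax.
  - by move=> c s bc /=; rewrite bx.
apply: (@mp_proj_pi_injective n x) => //; apply: gi.
- by move=> v bv /=; rewrite ax.
- by move=> v bv /=; rewrite bx.
have cG : continuous (fun z : cube R n * I => F (z, i1)) by cts.
exists (cts_of cG); split=> [v|v|v t bv]; rewrite cts_ofE /=.
- by rewrite Fe0 irev1 mp_start.
- by rewrite Fe1 irev1 mp_start.
- by rewrite Fl // irev1 mp_start ax.
Qed.

(** Slide [d] back along the path of [x] to a cube based at [g (mp_base x)], lift that up to
    homotopy to [al], and use the resulting homotopy from [g al] to [d] as paths, after correcting
    it over the boundary. *)
Lemma mp_end_pi_surjective n (x : N) :
  pi_surjective R g n (mp_base x) -> pi_surjective R mp_end n x.
Proof.
move=> gs d dx.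
have cr := @irev_continuous R.
have [|||D [cD D0 DA]] := @cube_hep R n W d (fun t => mp_path x (irev t)).
- exact: cts_fun.
- by cts.
- by move=> v bv; rewrite dx // irev0.
have cd' : continuous (fun v : cube R n => D (v, i1)) by cts.
have [|al alx [K [K0 K1 KA]]] := gs (cts_of cd').
  by move=> v bv; rewrite cts_ofE DA // irev1 mp_start.
pose C := concat K (fun z : cube R n * I => D (z.1, irev z.2)).
have cC : continuous C.
  apply: concat_continuous; [exact: cts_fun|by cts|].
  by move=> v; rewrite K1 /= irev0.
(* Over the boundary [C] waits during [K] and then runs along the path of [x] at double speed;
   clamping covers both halves. *)
have CA v t : cube_boundary v -> C (v, t) = mp_path x (iclamp (2 * ival t - 1)).
  move=> bv; rewrite /C /concat /=; case: ifP => t2.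
    by rewrite KA //= alx // -mp_start iclamp_le0 //; lra.
  rewrite DA // {1}/irev /irev; congr (mp_path x _); apply: (@ival_inj R).
  move/negbT: t2; rewrite -ltNge => t2; have t1 := ival_le1 t.
  by rewrite !ival_iclampT; lra.
(* Linear interpolation, with fixed end points, from this waiting parametrisation to the identity,
   as a lift based at [x] must follow the path of [x] itself. *)
pose th (z : I * I) : I := iclamp ((1 - ival z.2) * Num.max 0 (2 * ival z.1 - 1)
  + ival z.2 * ival z.1).
have [F [cF Ff Fe0 Fe1 Fl]] : exists F : cube R n * I * I -> W,
  [/\ continuous F,
    forall c t, F (c, t, i0) = C (c, t),
    forall c s, F (c, i0, s) = g (al c),
    forall c s, F (c, i1, s) = d c &
    forall c t s, cube_boundary c -> F (c, t, s) = mp_path x (th (t, s))].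
  apply: (@prism_hep R n W C (fun z => g (al z.1)) (fun z => d z.1)
    (fun z => mp_path x (th z))) => //.
  - by cts.
  - by cts.
  - by rewrite /th; cts.
  - by move=> c; rewrite /C concat0 K0.
  - by move=> c; rewrite /C concat1 irev1 D0.
  - move=> c t bc; rewrite CA //; congr (mp_path x _); rewrite /th /= ival0.
    rewrite subr0 mul1r mul0r addr0; have [h|h] := leP 0 (2 * ival t - 1) => //.
    by rewrite !iclamp_le0 // ltW.
  - move=> c s bc /=; rewrite alx // -mp_start; congr (mp_path x _).
    by rewrite /th /= ival0 mulr0 sub0r max_l ?iclamp_le0 //; lra.
  - move=> c s bc /=; rewrite dx //=; congr (mp_path x _).
    by rewrite /th /= ival1 max_r ?iclamp_ge1 //; lra.
have cP : continuous (fun z : cube R n * I => F (z, i1)) by cts.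
have cal : continuous al := @cts_fun _ _ al.
have e v : F (v, i0, i1) = g (al v) by rewrite Fe0.
have cA := @mapping_path_of_continuous R V W g _ _ _ cal cP e (@cube_k_space n).
exists (cts_of cA).
  move=> v bv; apply: mapping_path_eq => [|t] /=; first exact: alx.
  rewrite cts_ofE Fl //; congr (mp_path x _); rewrite /th /= ival1.
  by rewrite subrr mul0r add0r mul1r ivalK.
suff -> : ctscomp mp_end (cts_of cA) = d by exact: homotopic_refl.
by apply/continuousEP => v; exact: Fe1.
Qed.

Lemma mp_end_weq :
  weak_homotopy_equivalence R g -> weak_homotopy_equivalence R mp_end.
Proof.
move=> [gi gs gn]; have [pi _ _] := mp_proj_weq.
(* On components the end point therefore agrees with [g] after the projection. *)
have p (x : N) : path_connected_points R (g (mp_base x)) (mp_end x).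
  by exists (mp_path x); rewrite mp_start.
split.
- move=> x y xy; apply: pi; apply: gi.
  by apply: path_trans (p x) _; apply: path_trans xy _; exact/path_sym/p.
- move=> w; have [v [c [c0 c1]]] := gs w.
  exists (MappingPath c0); exists (cts_of (@cst_continuous_fun I W w)).
  by split=> //; exact: esym c1.
- move=> n x; have [gni gns] := gn n (mp_base x).
  by split; [exact: mp_end_pi_injective|exact: mp_end_pi_surjective].
Qed.

End mapping_path_factorisation.

(** * The mapping path flow *)

Lemma discrete_equalizer_clopen (T : topologicalType)
    (S : discreteTopologicalType) (f h : T -> S) :
  continuous f -> continuous h -> clopen [set x | f x = h x].
Proof.
move=> cf ch; split.
  have -> : [set x | f x = h x] = \bigcup_s (f @^-1` [set s] `&` h @^-1` [set s]).
    apply/seteqP; split=> x /=; first by move=> fh; exists (f x).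
    by move=> [s _ [/= -> ->]].
  apply: bigcup_open => s _; apply: openI;
    by apply: continuous_preimage_open => //; exact: discrete_open.
rewrite -openC.
have -> : ~` [set x | f x = h x] =
    \bigcup_s (f @^-1` [set s] `&` h @^-1` (~` [set s])).
  apply/seteqP; split=> x /=.
    by move=> fh; exists (f x) => //; split=> //= hf; exact: fh.
  by move=> [s _ [/= -> hs]] /esym.
apply: bigcup_open => s _; apply: openI;
  by apply: continuous_preimage_open => //; exact: discrete_open.
Qed.

Lemma comp_path_irr (X : flow) (x y : path_space X) (e e' : tgt x = src y) :
  comp_path e = comp_path e'.
Proof. by congr comp_path; exact: Prop_irrelevance. Qed.

(** Composable pairs live in a k-ified product, and a continuous map into the plain product lifts
    there when its domain is a k-space. *)
Lemma comp_path_along_continuous (X : flow) (T : topologicalType)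
    (a b : T -> path_space X) (ab : forall t, tgt (a t) = src (b t)) :
  k_space T -> continuous a -> continuous b ->
  continuous (fun t => comp_path (ab t)).
Proof.
move=> kT ca cb.
pose f (t : T) : set_type (composable (@src X) (@tgt X)) :=
  exist _ ((a t, b t) : kification _) (mem_set (ab t)).
have cf : continuous f.
  apply: set_type_continuous; apply: (kification_continuous kT).
  exact: pair_continuous.
have -> : (fun t => comp_path (ab t)) =
    (fun t => (fun p : set_type (composable (@src X) (@tgt X)) =>
      comp_path (set_valP p)) (f t)).
  by apply/funext => t; exact: (@comp_path_irr X (a t) (b t)).
exact: (comp_continuous cf (@comp_path_continuous X)).
Qed.

Lemma composable_k_space (P : cgType) (S : discreteTopologicalType)
    (s t : continuousType P S) : k_space (set_type (composable s t)).
Proof.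
have c1 (u : continuousType P S) :
    continuous (fun p : kification (P * P)%type => u p.1).
  by apply: (comp_continuous (@kification_val_continuous (P * P)%type)
    (g := fun p => u p.1)); cts.
have c2 (u : continuousType P S) :
    continuous (fun p : kification (P * P)%type => u p.2).
  by apply: (comp_continuous (@kification_val_continuous (P * P)%type)
    (g := fun p => u p.2)); cts.
have [oC cC] := discrete_equalizer_clopen (c1 t) (c2 s).
exact: (clopen_k_space (@kification_k_space (P * P)%type) oC cC).
Qed.

Section mapping_path_flow.
Variables (R : realType) (A B : flow) (g : flow_hom A B).
Local Notation I := (unit_interval R).
Local Notation i0 := (itv0 R).
Local Notation i1 := (itv1 R).
Local Notation N := (mapping_path R (on_path g)).

Lemma mf_src_continuous : continuous (fun x : N => src (mp_base x)).
Proof.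
by apply: (comp_continuous (@mp_base_continuous R _ _ (on_path g))); cts.
Qed.

Lemma mf_tgt_continuous : continuous (fun x : N => tgt (mp_base x)).
Proof.
by apply: (comp_continuous (@mp_base_continuous R _ _ (on_path g))); cts.
Qed.

Definition mf_src : continuousType N (state A) := cts_of mf_src_continuous.
Definition mf_tgt : continuousType N (state A) := cts_of mf_tgt_continuous.

(** States are discrete and the interval is connected. Paths with composable bases can thus be
    composed pointwise. *)
Lemma src_mp_path (x : N) t : src (mp_path x t) = on_state g (mf_src x).
Proof.
have c : continuous (fun t => src (mp_path x t)) by cts.
by rewrite (interval_connected c t i0) mp_start src_hom.
Qed.

Lemma tgt_mp_path (x : N) t : tgt (mp_path x t) = on_state g (mf_tgt x).
Proof.
have c : continuous (fun t => tgt (mp_path x t)) by cts.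
by rewrite (interval_connected c t i0) mp_start tgt_hom.
Qed.

Section composition.
Variables (x y : N) (xy : mf_tgt x = mf_src y).

Lemma mp_path_composable t : tgt (mp_path x t) = src (mp_path y t).
Proof. by rewrite tgt_mp_path src_mp_path xy. Qed.

Lemma mp_path_comp_continuous :
  continuous (fun t => comp_path (mp_path_composable t)).
Proof.
apply: comp_path_along_continuous; try exact: cts_fun.
exact/compact_hausdorff_k_space/interval_CH.
Qed.

Lemma mp_path_comp_start :
  comp_path (mp_path_composable i0) = on_path g (@comp_path A _ _ xy).
Proof.
rewrite (hom_comp_path xy (composable_hom g xy)).
(* The proof of composability is generalised first, since its type mentions the terms being
   rewritten. *)
move: (mp_path_composable i0); rewrite !mp_start => e; exact: comp_path_irr.
Qed.

Definition mf_comp : N :=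
  @MappingPath R _ _ (on_path g) (@comp_path A _ _ xy)
    (cts_of mp_path_comp_continuous) mp_path_comp_start.

End composition.

(** For compact Hausdorff [K] the product of [K] with the interval is a k-space, so the pointwise
    composites are jointly continuous and define a family of mapping paths. *)
Lemma mf_comp_along_continuous (K : topologicalType) (x y : K -> N)
    (xy : forall k, mf_tgt (x k) = mf_src (y k)) : compact_hausdorff K ->
  continuous x -> continuous y -> continuous (fun k => mf_comp (xy k)).
Proof.
move=> cK cx cy.
have ca : continuous (fun k => @comp_path A _ _ (xy k)).
  apply: comp_path_along_continuous; first exact: compact_hausdorff_k_space.
    exact: (comp_continuous cx (@mp_base_continuous R _ _ (on_path g))).
  exact: (comp_continuous cy (@mp_base_continuous R _ _ (on_path g))).
have ch : continuous
    (fun z : K * I => comp_path (mp_path_composable (xy z.1) z.2)).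
  apply: comp_path_along_continuous.
  - apply: compact_hausdorff_k_space.
    exact: prod_compact_hausdorff cK (@interval_CH R).
  - by apply: mp_along_continuous; cts.
  - by apply: mp_along_continuous; cts.
have e k : comp_path (mp_path_composable (xy k) i0) =
    on_path g (@comp_path A _ _ (xy k)) by exact: mp_path_comp_start.
have -> : (fun k => mf_comp (xy k)) = mapping_path_of ch e.
  by apply/funext => k; apply: mapping_path_eq.
exact: (@mapping_path_of_continuous _ _ _ _ _ _ _ ca ch e
  (compact_hausdorff_k_space cK)).
Qed.

Lemma mf_comp_continuous :
  continuous (fun p : set_type (composable mf_src mf_tgt) =>
    mf_comp (set_valP p)).
Proof.
apply: k_space_continuous; first exact: composable_k_space.
move=> K cK u.
have cu : continuous (fun k => set_val (u k) : N * N).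
  exact: (comp_continuous (comp_continuous (@cts_fun _ _ u)
    (@set_val_continuous _ _)) (@kification_val_continuous (N * N)%type)).
exact: (@mf_comp_along_continuous K (fun k => (set_val (u k) : N * N).1)
  (fun k => (set_val (u k) : N * N).2) (fun k => set_valP (u k)) cK
  (comp_continuous cu (@fst_continuous _ _))
  (comp_continuous cu (@snd_continuous _ _))).
Qed.

Definition mapping_path_flow : flow.
Proof.
apply: (@Flow N (state A) mf_src mf_tgt mf_comp mf_comp_continuous).
- by move=> x y xy; exact: src_comp.
- by move=> x y xy; exact: tgt_comp.
- move=> x y z xy yz xy_z x_yz; apply: mapping_path_eq => [|t].
    exact: comp_pathA.
  exact: comp_pathA.
Defined.

Definition mf_proj : flow_hom mapping_path_flow A.
Proof.
apply: (@FlowHom mapping_path_flow A id (mp_proj R (on_path g))) => //.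
by move=> x y xy fxy; exact: comp_path_irr.
Defined.

Definition mf_end : flow_hom mapping_path_flow B.
Proof.
apply: (@FlowHom mapping_path_flow B (on_state g) (mp_end R (on_path g))).
- by move=> x; exact: src_mp_path.
- by move=> x; exact: tgt_mp_path.
- by move=> x y xy fxy; exact: comp_path_irr.
Defined.

End mapping_path_flow.

(** * Flows and branching spaces *)

Lemma bijective_cancel (X Y Z : Type) (f : X -> Y) (h : Y -> Z) :
  bijective h -> bijective (h \o f) -> bijective f.
Proof.
move=> [h' hK h'K] bhf; apply: (@eq_bij _ _ (h' \o (h \o f))).
  by apply: bij_comp => //; exists h.
by move=> x /=; rewrite hK.
Qed.

Section weak_S_homotopy_equivalences.
Variable R : realType.

Lemma weak_S_comp (X Y Z : flow) (f : flow_hom X Y) (g : flow_hom Y Z) :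
  weak_S_homotopy_equivalence R f -> weak_S_homotopy_equivalence R g ->
  weak_S_homotopy_equivalence R (flow_comp g f).
Proof.
move=> [bf wf] [bg wg]; split; first exact: bij_comp.
exact: weak_homotopy_equivalence_comp.
Qed.

Lemma weak_S_cancel (X Y Z : flow) (f : flow_hom X Y) (g : flow_hom Y Z) :
  weak_S_homotopy_equivalence R g ->
  weak_S_homotopy_equivalence R (flow_comp g f) ->
  weak_S_homotopy_equivalence R f.
Proof.
move=> [bg wg] [bgf wgf]; split; first exact: bijective_cancel bg bgf.
exact: weak_homotopy_equivalence_cancel wg wgf.
Qed.

Lemma weak_S_id (X : flow) : weak_S_homotopy_equivalence R (flow_id X).
Proof.
by split; [exists id|exact: weak_homotopy_equivalence_id].
Qed.

(** Composability [e] is assumed only so that the composite can be written: it is automatic, as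
    sources and targets do not vary with [t]. *)
Definition flow_homotopic (X Y : flow) (f f' : flow_hom X Y) :=
  exists H : continuousType (path_space X * unit_interval R)%type (path_space Y),
    [/\ forall x, H (x, itv0 R) = on_path f x,
        forall x, H (x, itv1 R) = on_path f' x &
        forall x y t (xy : tgt x = src y) (e : tgt (H (x, t)) = src (H (y, t))),
          H (comp_path xy, t) = comp_path e].

(** A section of the trivial fibration [mf_end] is a map to [A] together with a
    homotopy. *)
Lemma weak_S_right_inverse (A B : flow) (g : flow_hom A B) :
  cofibrant (Flow_weq R) (Flow_fib R) empty_Flow (B : Flows) ->
  weak_S_homotopy_equivalence R g ->
  exists r : flow_hom B A, weak_S_homotopy_equivalence R r /\
    flow_homotopic (flow_comp g r) (flow_id B).
Proof.
move=> cB [bg wg].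
have we : weak_S_homotopy_equivalence R (mf_end R g).
  by split; [exact: bg|exact: mp_end_weq].
have wp : weak_S_homotopy_equivalence R (mf_proj R g).
  by split; [exists id|exact: mp_proj_weq].
have tf : @trivial_fibration Flows (Flow_weq R) (Flow_fib R) _ _ (mf_end R g).
  by split=> //; exact: mp_end_serre_fibration.
have [|s [_ ps]] := cB _ _ _ tf (from_empty_flow _) (flow_id B).
  by rewrite [LHS]from_empty_flow_uniq [RHS]from_empty_flow_uniq.
have ps1 b : mp_path (on_path s b) (itv1 R) = b.
  by have := congr1 (fun k : flow_hom B B => on_path k b) ps.
(* A section of a weak equivalence is one, by cancellation. *)
have ws : weak_S_homotopy_equivalence R s.
  by apply: (weak_S_cancel we); rewrite [flow_comp _ _]ps; exact: weak_S_id.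
exists (flow_comp (mf_proj R g) s); split; first exact: weak_S_comp.
have cH : continuous (fun z : path_space B * unit_interval R =>
    mp_path (on_path s z.1) z.2).
  by apply: mp_along_continuous; cts.
exists (cts_of cH); split=> [x|x|x y t xy e]; rewrite ?cts_ofE /=.
- exact: mp_start.
- exact: ps1.
- rewrite (hom_comp_path xy (composable_hom s xy)).
  exact: comp_path_irr.
Qed.

End weak_S_homotopy_equivalences.

(** * Homotopy invariance of branching spaces *)

Section branching_theory.
Variable R : realType.

Lemma branching_ext (X : flow) (BX : branching_space X) (Z : cgType)
    (f h : continuousType (branching BX) Z) :
  (forall x, f (branching_proj BX x) = h (branching_proj BX x)) -> f = h.
Proof.
move=> fh.
have inv : branching_invariant (ctscomp h (branching_proj BX)).
  by move=> x y xy /=; congr (h _); exact: branching_projP.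
have [k [_ ku]] := branching_universal BX inv.
by rewrite -(ku h) // -(ku f).
Qed.

(** The universal property concerns maps out of a path space, not out of its product with the
    interval. The homotopy is therefore transposed to a map into a space of paths, descended, and
    transposed back. *)
Lemma branching_homotopic (X Y : flow) (BX : branching_space X)
    (BY : branching_space Y) (f f' : flow_hom X Y) :
  flow_homotopic R f f' ->
  homotopic R (branching_map BX BY f) (branching_map BX BY f').
Proof.
move=> [H [H0 H1 HM]].
have Hcomp x y t (xy : tgt x = src y) : tgt (H (x, t)) = src (H (y, t)).
  have ct : continuous (fun t => tgt (H (x, t))).
    by apply: (comp_continuous (f := fun t => (x, t))
      (g := fun z => tgt (H z))); cts.
  have cs : continuous (fun t => src (H (y, t))).
    by apply: (comp_continuous (f := fun t => (y, t))
      (g := fun z => src (H z))); cts.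
  rewrite (interval_connected ct t (itv0 R)).
  rewrite (interval_connected cs t (itv0 R)).
  by rewrite !H0 tgt_hom src_hom xy.
(* The mapping path space of the identity is the space of all paths. *)
pose Z : cgType := mapping_path R (ctsid (branching BY)).
have ca : continuous (fun x => branching_proj BY (H (x, itv0 R))).
  apply: (comp_continuous (f := fun x => (x, itv0 R))
      (g := fun z => branching_proj BY (H z))); first by cts.
  by cts.
have ch : continuous (fun z => branching_proj BY (H z)) by cts.
have cphi := @mapping_path_of_continuous R _ _ (ctsid (branching BY)) _ _ _
  ca ch (fun=> erefl) (@cg_k_space (path_space X)).
have inv : branching_invariant (cts_of cphi : continuousType _ Z).
  move=> x y xy; apply: mapping_path_eq => [|t] /=.
    by rewrite (HM _ _ _ _ (Hcomp _ _ _ xy)); exact: branching_projP.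
  rewrite !cts_ofE (HM _ _ _ _ (Hcomp _ _ _ xy)); exact: branching_projP.
have [psi [psiE _]] := branching_universal BX inv.
have cG : continuous (fun z : branching BX * unit_interval R =>
    mp_path (psi z.1 : mapping_path R (ctsid (branching BY))) z.2).
  by apply: mp_along_continuous; cts.
(* Wherever [H] restricts to a morphism, uniqueness identifies the descended map with its branching
   map; this is used at both ends. *)
have end_ (t : unit_interval R) (k : flow_hom X Y) :
    (forall x, H (x, t) = on_path k x) ->
    forall z, cts_of cG (z, t) = branching_map BX BY k z.
  move=> Hk z.
  have ck : continuous (fun z => cts_of cG (z, t)).
    apply: (comp_continuous (f := fun z => (z, t))
      (g := cts_of cG)); first by cts.
    exact: cts_fun.
  suff -> : branching_map BX BY k = cts_of ck by [].
  apply: branching_ext => x; rewrite branching_mapE !cts_ofE /= psiE -Hk.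
  by [].
by exists (cts_of cG); split=> // z; exact: end_.
Qed.

Lemma branching_map_comp (X Y Z : flow) (BX : branching_space X)
    (BY : branching_space Y) (BZ : branching_space Z) (f : flow_hom X Y)
    (g : flow_hom Y Z) : branching_map BX BZ (flow_comp g f) =
  ctscomp (branching_map BY BZ g) (branching_map BX BY f).
Proof. by apply: branching_ext => x; rewrite /= !branching_mapE. Qed.

Lemma branching_map_id (X : flow) (BX : branching_space X) :
  branching_map BX BX (flow_id X) = ctsid (branching BX).
Proof. by apply: branching_ext => x; rewrite branching_mapE. Qed.

Lemma branching_homotopy_equivalence (A B : flow) (BA : branching_space A)
    (BB : branching_space B) (g : flow_hom A B) :
  cofibrant (Flow_weq R) (Flow_fib R) empty_Flow (A : Flows) ->
  cofibrant (Flow_weq R) (Flow_fib R) empty_Flow (B : Flows) ->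
  weak_S_homotopy_equivalence R g ->
  homotopy_equivalence R (branching_map BA BB g).
Proof.
move=> cA cB wg.
have [r [wr gr]] := weak_S_right_inverse cB wg.
have [r' [_ rr']] := weak_S_right_inverse cA wr.
have := branching_homotopic BB BB gr; have := branching_homotopic BA BA rr'.
rewrite !branching_map_id (branching_map_comp _ BB) (branching_map_comp _ BA).
set G := branching_map BA BB g; set S := branching_map BB BA r.
set S' := branching_map BA BB r' => SS' GS.
exists S; split=> //.
(* The missing homotopy is the chain [S G ~ S G S S' ~ S S' ~ id], the middle step using
   [G S ~ id]. *)
have SG : homotopic R (ctscomp S G) (ctscomp (ctscomp S G) (ctscomp S S')).
  apply: homotopic_sym.
  have E : ctscomp (ctscomp S G) (ctsid _) = ctscomp S G by apply/continuousEP.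
  by rewrite -[X in homotopic_rel _ _ _ X]E; exact: homotopic_post.
apply: homotopic_trans SG _; apply: homotopic_trans SS'.
have -> : ctscomp (ctscomp S G) (ctscomp S S') =
    ctscomp S (ctscomp (ctscomp G S) S') by apply/continuousEP.
apply: homotopic_post.
have E : ctscomp (ctsid _) S' = S' by apply/continuousEP.
by rewrite -[X in homotopic_rel _ _ _ X]E; exact: homotopic_pre.
Qed.

End branching_theory.

(** * Cofibrancy of branching spaces *)

Section right_adjoint.
Variable R : realType.

Lemma left_zero_comp_continuous (Z : cgType)
    (s t : continuousType Z (discrete_topology unit)) :
  continuous (fun p : set_type (composable s t) => (set_val p : Z * Z).1).
Proof.
exact: (comp_continuous (comp_continuous (@set_val_continuous _ (composable s t))
  (@kification_val_continuous (Z * Z)%type)) (@fst_continuous Z Z)).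
Qed.

Definition to_point (Z : cgType) : continuousType Z (discrete_topology unit) :=
  cts_of (@cst_continuous_fun Z (discrete_topology unit) tt).

(** The right adjoint of the branching space functor. *)
Definition left_zero_flow (Z : cgType) : flow.
Proof.
apply: (@Flow Z (discrete_topology unit) (to_point Z) (to_point Z)
  (fun x _ _ => x)) => //.
exact: left_zero_comp_continuous.
Defined.

Definition left_zero_map (Z Z' : cgType) (f : continuousType Z Z') :
  flow_hom (left_zero_flow Z) (left_zero_flow Z').
Proof. exact: (@FlowHom (left_zero_flow Z) (left_zero_flow Z') id f). Defined.

Definition left_zero_transpose (A : flow) (Z : cgType)
    (f : continuousType (path_space A) Z) (fI : branching_invariant f) :
  flow_hom A (left_zero_flow Z).
Proof.
apply: (@FlowHom A (left_zero_flow Z) (fun=> tt) f) => //.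
by move=> x y xy fxy /=; rewrite -fI.
Defined.

Lemma branching_cofibrant (A : flow) (BA : branching_space A) :
  cofibrant (Flow_weq R) (Flow_fib R) empty_Flow (A : Flows) ->
  cofibrant_space R (branching BA).
Proof.
move=> cA E B p [Wp Fp] u v uv.
have vI : branching_invariant (ctscomp v (branching_proj BA)).
  by move=> x y xy /=; congr (Continuous.sort v _); exact: branching_projP.
have tf : @trivial_fibration Flows (Flow_weq R) (Flow_fib R) _ _
    (left_zero_map p).
  by split=> //; split=> //; exists id.
have [|h [_ ph]] := cA _ _ _ tf (from_empty_flow _) (left_zero_transpose vI).
  by rewrite [LHS]from_empty_flow_uniq [RHS]from_empty_flow_uniq.
(* The law [x * y = x] in the target turns compatibility with composition into branching
   invariance. *)
have hI : branching_invariant (on_path h).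
  by move=> x y xy; rewrite (hom_comp_path xy (composable_hom h xy)).
have [psi [psiE _]] := branching_universal BA hI.
(* The upper triangle commutes because it starts at the initial object. *)
exists psi; split; first by rewrite [LHS]empty_map_uniq [RHS]empty_map_uniq.
apply: branching_ext => x /=; rewrite psiE.
by have := congr1 (fun k : flow_hom A (left_zero_flow B) => on_path k x) ph.
Qed.

End right_adjoint.

Theorem corollary5p7 (R : realType) (Q : flow_cofibrant_replacement R)
    (Pm : forall X : flow, branching_space X)
    (X Y : flow) (f : flow_hom X Y) :
  weak_S_homotopy_equivalence R f ->
  [/\ cofibrant_space R (ho_branching Q Pm X),
      cofibrant_space R (ho_branching Q Pm Y) &
      homotopy_equivalence R (ho_branching_map Q Pm f)].
Proof.
move=> wf; have cX := @crep_cofibrant _ _ _ _ Q X.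
have cY := @crep_cofibrant _ _ _ _ Q Y.
split; [exact: branching_cofibrant|exact: branching_cofibrant|].
apply: branching_homotopy_equivalence => //.
have [wX _] := @crep_tfib _ _ _ _ Q X; have [wY _] := @crep_tfib _ _ _ _ Q Y.
(* By naturality [Q f] followed by the replacement map of [Y] equals the replacement map of [X]
   followed by [f], a composite of weak equivalences. *)
apply: (weak_S_cancel wY).
rewrite [flow_comp _ _](crep_natural Q (f : Defs.hom (X : Flows) Y)).
exact: weak_S_comp.
Qed.
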